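(* Let $\mathcal H$ be a finite dimensional real Hilbert space, $K\subset\mathcal H$ a nonempty closed convex set, $q\ge1$ an integer, and let $f_i:\mathcal H\to\mathbb R$ ($i=1,\dots,q$) be convex continuous functions that are Lipschitz continuous on bounded sets and bounded from below on $\mathcal H$. Then, for any initial data $u_0\in K$, there exists a strong global solution $u:[0,+\infty[\to\mathcal H$ of the Multi-Objective Gradient system $$\text{(MOG)}\qquad \dot u(t)+\Big(N_K(u(t))+\mathrm{Conv}\{\partial f_i(u(t))\}\Big)^0=0,$$ which satisfies $u(0)=u_0$.
   Context: $N_K(u)=\{\eta\in\mathcal H:\langle\eta,v-u\rangle\le0\ \forall v\in K\}$ for $u\in K$ (and $N_K(u)=\emptyset$ for $u\notin K$) is the normal cone; $\partial f_i$ is the convex subdifferential. $\mathcal S^q=\{\theta\in\mathbb R^q:0\le\theta_i\le1,\ \sum_i\theta_i=1\}$ and $\mathrm{Conv}\{\partial f_i(u)\}=\{\sum_{i=1}^q\theta_ip_i:\ p_i\in\partial f_i(u),\ (\theta_i)\in\mathcal S^q\}$. For a nonempty closed convex set $C$, $C^0$ is its element of minimal norm. A strong global solution of (MOG) is a function $u:[0,+\infty[\to\mathcal H$ such that: (i) $u$ is absolutely continuous on each interval $[0,T]$, $0<T<+\infty$ (i.e. $u(t)=u(0)+\int_0^tg(s)\,ds$ for some integrable $g:[0,T]\to\mathcal H$); (ii) there exist $\eta:[0,+\infty[\to\mathcal H$, $v_i:[0,+\infty[\to\mathcal H$, $\theta_i:[0,+\infty[\to[0,1]$ ($i=1,\dots,q$)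 with $\theta_i\in L^\infty(0,+\infty;\mathbb R)$, $(\theta_i(t))\in\mathcal S^q$ for a.e. $t>0$; $v_i\in L^\infty(0,T;\mathcal H)$ and $\eta\in L^2(0,T;\mathcal H)$ for all $T>0$; and for a.e. $t>0$: $\eta(t)\in N_K(u(t))$, $v_i(t)\in\partial f_i(u(t))$, $\dot u(t)+\eta(t)+\sum_i\theta_i(t)v_i(t)=0$, and $\dot u(t)+\big(N_K(u(t))+\mathrm{Conv}\{\partial f_i(u(t))\}\big)^0=0$. *)

(* Defs.v *)
From HB Require Import structures.
From mathcomp Require Import all_boot all_order all_algebra.
From mathcomp Require Import all_classical all_reals all_analysis.

Set Implicit Arguments.
Unset Strict Implicit.
Unset Printing Implicit Defensive.

Import Order.TTheory GRing.Theory Num.Theory.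
Import numFieldNormedType.Exports.

Local Open Scope classical_set_scope.
Local Open Scope ring_scope.

(* Finite-dimensional normed spaces. A finite-dimensional real Hilbert space is
   a [normedVectType R] together with a [form : {dot H for idfun}] satisfying
   [hilbert_norm form]; completeness is automatic in finite dimension. *)
#[short(type="normedVectType")]
HB.structure Definition NormedVect (K : numFieldType) :=
  {V of NormedModule K V & Vector K V}.

Section hilbert.
Context {R : realType} {H : normedVectType R}.
Variable form : {dot H for idfun}.

Definition hilbert_norm := forall x : H, `|x| ^+ 2 = form x x.

Definition normal_cone (K : set H) (u : H) : set H :=
  [set eta | K u /\ forall v, K v -> form eta (v - u) <= 0].

Definition subdiff (f : H -> R) (u : H) : set H :=
  [set p | forall y, f u + form p (y - u) <= f y].

Definition unit_simplex (q : nat) : set ('I_q -> R) :=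
  [set theta | (forall i, 0 <= theta i <= 1) /\ \sum_i theta i = 1].

Definition conv_subdiff (q : nat) (f : 'I_q -> H -> R) (u : H) : set H :=
  [set w | exists theta p, [/\ unit_simplex theta,
     forall i, subdiff (f i) u (p i) & w = \sum_i theta i *: p i]].

(* [is_min_norm C c] reads c = C^0. *)
Definition is_min_norm (C : set H) (c : H) :=
  C c /\ forall y, C y -> `|c| <= `|y|.

End hilbert.

Section vector_valued.
Context {R : realType} {H : normedVectType R}.
Local Notation mu := (@lebesgue_measure R).

Definition vmeasurable (D : set R) (g : R -> H) :=
  measurable_fun (D : set (measurableTypeR R))
    (g : measurableTypeR R -> g_sigma_algebraType (@open H)).

Definition vintegrable (D : set R) (g : R -> H) :=
  vmeasurable D g /\ mu.-integrable D (fun s => `|g s|%:E).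

(* The Lebesgue integral of an [H]-valued function, taken coordinatewise; by
   linearity its value does not depend on the basis when [vintegrable D g]. *)
Definition vintegral (D : set R) (g : R -> H) : H :=
  \sum_(i < \dim {:H})
    (\int[mu]_(s in D) coord (vbasis {:H}) i (g s)) *: (vbasis {:H})`_i.

(* g belongs to L^p(D; H) *)
Definition vLfun (p : \bar R) (D : set R) (g : R -> H) :=
  vmeasurable D g /\ (fun t => `|g t|) \_ D \in Lfun mu p.

Definition abs_continuous (u : R -> H) (T : R) :=
  exists2 g : R -> H, vintegrable `[0, T]%classic g &
    forall t, t \in `[0, T] -> u t = u 0 + vintegral `[0, t]%classic g.

End vector_valued.

(* Functions on [0, +oo[ are represented by functions on R whose values at
   negative arguments are irrelevant. *)
Definition strong_global_solution (R : realType) (H : normedVectType R)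
    (form : {dot H for idfun}) (K : set H) (q : nat) (f : 'I_q -> H -> R)
    (u : R -> H) :=
  let mu := @lebesgue_measure R in
  (forall T, 0 < T -> abs_continuous u T) /\
  exists (eta : R -> H) (v : 'I_q -> R -> H) (theta : 'I_q -> R -> R),
  [/\ forall i t, 0 <= t -> 0 <= theta i t <= 1,
      forall i, theta i \_ `]0, +oo[%classic \in Lfun mu +oo%E,
      {ae mu, forall t, 0 < t -> unit_simplex (theta ^~ t)},
      (forall T, 0 < T ->
        (forall i, vLfun +oo%E `]0, T[%classic (v i)) /\ vLfun 2%:E `]0, T[%classic eta) &
      {ae mu, forall t, 0 < t ->
        [/\ derivable u t 1,
            normal_cone form K (u t) (eta t),
            forall i, subdiff form (f i) (u t) (v i t),
            derive1 u t + eta t + \sum_i theta i t *: v i t = 0 &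
            exists2 c, is_min_norm [set x + y | x in normal_cone form K (u t)
                                   & y in conv_subdiff form f (u t)] c &
                       derive1 u t + c = 0]}].

(* Main.v *)
Require Import Defs.
From HB Require Import structures.
From mathcomp Require Import all_boot all_order all_algebra.
From mathcomp Require Import all_classical all_reals all_analysis.
From mathcomp Require Import measurable_realfun ess_sup_inf.
From mathcomp Require Import ring lra.

(* The solution is a limit of the implicit scheme x_{k+1} = argmin over K of
   max_i (f_i - f_i (x_k)) + |. - x_k|^2 / (2h).  A step satisfies
   x_{k+1} = x_k - h (eta_k + sum_i theta_{k,i} p_{k,i}) with eta_k normal to K,
   p_{k,i} a subgradient of f_i and theta_k in the simplex, together with
   f_i (x_{k+1}) - f_i (x_k) <= - |x_{k+1} - x_k|^2 / h for every i.  No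
   separation theorem is needed for it: replacing the maximum by a log-sum-exp
   and decoupling f_i and the indicator of K by quadratic penalties makes the
   first-order conditions elementary, and the penalties are sent to infinity.

   The time integrals of eta, theta_i, theta_i p_i and p_i along the scheme are
   uniformly locally Lipschitz, hence converge pointwise along an ultrafilter to
   locally Lipschitz curves, which are differentiable almost everywhere and
   integrals of their derivatives (Lebesgue-Stieltjes, Radon-Nikodym).  All the
   inclusions are linear inequalities in averages of the discrete quantities
   over a window, so they pass to the derivatives of these curves; this yields
   measurable selections without any selection theorem or weak compactness.
   Finally the energy estimate gives <z, u'> <= - |u'|^2 for every z in
   N_K(u) + Conv {subdiff f_i (u)}, which contains - u', and Cauchy-Schwarz
   identifies - u' as its element of minimal norm. *)

Set Implicit Arguments.
Unset Strict Implicit.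
Unset Printing Implicit Defensive.

Import Order.TTheory GRing.Theory Num.Theory.
Import numFieldNormedType.Exports.

Local Open Scope classical_set_scope.
Local Open Scope ring_scope.

(** * Inner product calculus *)

Section inner_product.
Context {R : realType} {H : normedVectType R}.
Variable form : {dot H for idfun}.
Hypothesis hform : hilbert_norm form.
Implicit Types x y z : H.

Lemma dotC x y : form x y = form y x.
Proof. by rewrite (hermC form x y) expr0 mul1r. Qed.

Lemma dotDl x y z : form (x + y) z = form x z + form y z.
Proof. exact: linearDl. Qed.
Lemma dotDr x y z : form z (x + y) = form z x + form z y.
Proof. exact: linearDr. Qed.
Lemma dotNl x z : form (- x) z = - form x z.
Proof. exact: linearNl. Qed.
Lemma dotNr x z : form z (- x) = - form z x.
Proof. exact: linearNr. Qed.
Lemma dotZl a x z : form (a *: x) z = a * form x z.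
Proof. exact: linearZl_LR. Qed.
Lemma dotZr a x z : form z (a *: x) = a * form z x.
Proof. exact: linearZr_LR. Qed.
Lemma dot0l z : form 0 z = 0.
Proof. exact: linear0l. Qed.
Lemma dot0r z : form z 0 = 0.
Proof. exact: linear0r. Qed.
Lemma dot_suml I (r : seq I) (P : pred I) (F : I -> H) z :
  form (\sum_(i <- r | P i) F i) z = \sum_(i <- r | P i) form (F i) z.
Proof. exact: linear_sumlz. Qed.

Definition dotE := (dotDl, dotDr, dotNl, dotNr, dotZl, dotZr).

Lemma normD2 x y : `|x + y| ^+ 2 = `|x| ^+ 2 + 2 * form x y + `|y| ^+ 2.
Proof. rewrite !hform !dotE (dotC y x); ring. Qed.

(** Cauchy-Schwarz: expand the square of the norm of [|y| x - |x| y], which is nonnegative, and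
    divide by [2 |x| |y|]. *)
Lemma dot_le_norm x y : form x y <= `|x| * `|y|.
Proof.
have [->|x0] := eqVneq x 0; first by rewrite dot0l normr0 mul0r.
have [->|y0] := eqVneq y 0; first by rewrite dot0r normr0 mulr0.
have nx : 0 < `|x| by rewrite normr_gt0.
have ny : 0 < `|y| by rewrite normr_gt0.
have : 0 <= `|(`|y| *: x) + (- `|x|) *: y| ^+ 2 by rewrite sqr_ge0.
rewrite normD2 !dotE !normrZ !normrN !normr_id !exprMn => h.
have : 0 <= (`|x| * `|y|) * (`|x| * `|y| - form x y) by lra.
by rewrite pmulr_rge0 ?mulr_gt0// subr_ge0.
Qed.

Lemma dot_polar x y : form x y = 2^-1 * (`|x + y| ^+ 2 - `|x| ^+ 2 - `|y| ^+ 2).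
Proof. by rewrite normD2; field. Qed.

(** Polarisation writes the form through norms, so its joint continuity reduces to that of the
    norm. *)
Lemma cvg_dot T (F : set_system T) {FF : Filter F} (a b : T -> H) x y :
  a @ F --> x -> b @ F --> y -> (fun t => form (a t) (b t)) @ F --> form x y.
Proof.
move=> ax by_; rewrite dot_polar; under eq_fun do rewrite dot_polar.
apply: cvgM; first exact: cvg_cst.
have sq (c : T -> H) z : c @ F --> z -> `|c t| ^+ 2 @[t --> F] --> `|z| ^+ 2.
  by move=> cz; rewrite expr2; under eq_fun do rewrite expr2;
     apply: cvgM; exact: cvg_norm.
apply: cvgB; last exact: sq.
by apply: cvgB; apply: sq => //; exact: cvgD.
Qed.

End inner_product.

(** * Limits and compactness in finite dimension *)

Lemma cvg_sum (R : numFieldType) (V : normedModType R) T (F : set_system T)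
    {FF : Filter F} I (r : seq I) (P : pred I) (f : I -> T -> V) (l : I -> V) :
  (forall i, P i -> f i @ F --> l i) ->
  (fun t => \sum_(i <- r | P i) f i t) @ F --> \sum_(i <- r | P i) l i.
Proof.
move=> fl; elim: r => [|i r IH].
  by rewrite big_nil; under eq_fun do rewrite big_nil; exact: cvg_cst.
rewrite big_cons; under eq_fun do rewrite big_cons.
by case: ifP => // Pi; apply: cvgD => //; exact: fl.
Qed.

Section finite_dimension.
Context {R : realType} {H : normedVectType R}.
Local Notation n := (\dim {:H}).
Local Notation e := (vbasis {:H}).

Definition vec_of_row (a : 'rV[R]_n) : H := \sum_(i < n) a ord0 i *: e`_i.

Lemma coord_vec_of_row (a : 'rV[R]_n) i : coord e i (vec_of_row a) = a ord0 i.
Proof. by rewrite /vec_of_row coord_sum_free// (basis_free (vbasisP _)). Qed.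

Lemma vec_of_row_coord (x : H) : vec_of_row (\row_i coord e i x) = x.
Proof.
rewrite [RHS](coord_vbasis (memvf x)) /vec_of_row.
by apply: eq_bigr => i _; rewrite mxE.
Qed.

Lemma vec_of_row_linear : linear vec_of_row.
Proof.
move=> c a b; rewrite /vec_of_row scaler_sumr -big_split/=.
by apply: eq_bigr => i _; rewrite !mxE scalerDl scalerA.
Qed.

Lemma continuous_vec_of_row : continuous vec_of_row.
Proof.
move=> a; apply: (@cvg_sum _ _ _ (nbhs a) _) => i _; apply: cvgZr_tmp.
exact: coord_continuous.
Qed.

Lemma continuous_norm_vec_of_row : continuous (fun a => `|vec_of_row a|).
Proof. move=> a; exact: (cvg_norm (@continuous_vec_of_row a)). Qed.

(** Equivalence of norms: [|vec_of_row a|] attains a minimum on the compact unit sphere of rows,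
    positive because coordinates are unique. Its inverse is the constant, by homogeneity. *)
Lemma row_norm_bound :
  exists2 C : R, 0 < C & forall a : 'rV[R]_n, `|a| <= C * `|vec_of_row a|.
Proof.
pose S := [set a : 'rV[R]_n | `|a| = 1].
have L c a : vec_of_row (c *: a) = c *: vec_of_row a.
  have V0 : vec_of_row 0 = 0.
    by rewrite /vec_of_row big1// => i _; rewrite mxE scale0r.
  by rewrite -[c *: a]addr0 vec_of_row_linear V0 addr0.
(* The sphere is empty when the space is trivial; every row is then [0]. *)
have [S0|/set0P S0] := eqVneq S set0.
  exists 1 => // a; have [->|a0] := eqVneq a 0.
    by rewrite normr0 mul1r.
  have : S (`|a|^-1 *: a).
    by rewrite /S/= normrZ normfV normr_id mulVf ?normr_eq0.
  by rewrite S0.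
have Sc : compact S.
  apply: bounded_closed_compact.
    by exists 1; split => // M M1 a /= ->; exact: ltW.
  have /continuous_closedP nC := @norm_continuous R 'rV[R]_n.
  exact: (nC [set y : R | y = 1] (@closed_eq _ _)).
have [|c cS cmin] := @compact_EVT_min _ R (fun a => `|vec_of_row a|) S S0 Sc.
  by apply: continuous_subspaceT; exact: continuous_norm_vec_of_row.
have c0 : 0 < `|vec_of_row c|.
  rewrite normr_gt0; apply/eqP => Vc0.
  have : c = 0.
    by apply/rowP => i; rewrite -coord_vec_of_row Vc0 linear0 mxE.
  move=> c0; move: cS; rewrite inE /S/= c0 normr0 => /esym/eqP.
  by rewrite oner_eq0.
exists `|vec_of_row c|^-1; first by rewrite invr_gt0.
move=> a; have [->|a0] := eqVneq a 0.
  by rewrite normr0 mulr_ge0// invr_ge0 ltW.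
have : `|vec_of_row c| <= `|vec_of_row (`|a|^-1 *: a)|.
  by apply: cmin; rewrite inE /S/= normrZ normfV normr_id mulVf ?normr_eq0.
rewrite L normrZ normfV normr_id -ler_pdivrMl ?invr_gt0 ?normr_gt0// invrK.
by rewrite -ler_pdivrMl ?invr_gt0// invrK mulrC.
Qed.

Lemma coord_bound : exists2 C : R, 0 < C &
  forall (i : 'I_n) (x : H), `|coord e i x| <= C * `|x|.
Proof.
have [C C0 HC] := row_norm_bound; exists C => // i x.
rewrite -{2}(vec_of_row_coord x); apply: le_trans (HC _).
have -> : coord e i x = (\row_i coord e i x) ord0 i by rewrite mxE.
rewrite [leRHS]/Num.norm/= mx_normrE.
by apply: le_trans (le_bigmax _ _ (ord0, i)).
Qed.

Lemma compact_closed_ball0 (r : R) : compact [set x : H | `|x| <= r].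
Proof.
have [C C0 HC] := row_norm_bound.
have -> : [set x : H | `|x| <= r] =
    vec_of_row @` [set a | `|vec_of_row a| <= r].
  apply/seteqP; split => [x xr|_ [a ar <-]//].
  by exists (\row_i coord e i x); rewrite /= vec_of_row_coord.
apply: continuous_compact.
  exact/continuous_subspaceT/continuous_vec_of_row.
apply: bounded_closed_compact.
  exists (C * r); split; first exact: num_real.
  move=> M CM a /= ar; apply: le_trans (HC a) _.
  by apply: le_trans (ltW CM); rewrite ler_pM2l.
have /continuous_closedP nC := continuous_norm_vec_of_row.
exact: (nC [set y : R | y <= r] (@closed_le _ _)).
Qed.

End finite_dimension.

(** An ultrafilter converges to each of its cluster points. One fixed ultrafilter thus gives limits
    to all bounded sequences at once, for every time [t], without extracting subsequences. *)
Lemma ultra_compact_cvg (I : Type) (U : set_system I) (T : topologicalType)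
    (A : set T) (x : I -> T) :
  UltraFilter U -> compact A -> (forall i, A (x i)) ->
  exists2 p, A p & x @ U --> p.
Proof.
move=> UU cA xA.
have [|p [Ap clp]] := cA (x @ U) _; first exact: nearW.
exists p => // B pB.
have [//|nB] := in_ultra_setVsetC (x @^-1` B) UU.
have nB' : (x @ U) (~` B) by [].
by have [y [nBy By]] := clp _ _ nB' pB.
Qed.

Lemma ultra_bounded_cvg (R : realType) (H : normedVectType R) (I : Type)
    (U : set_system I) (x : I -> H) (M : R) :
  UltraFilter U -> (forall i, `|x i| <= M) -> cvg (x @ U).
Proof.
move=> UU xM; have [p _ xp] := ultra_compact_cvg UU (@compact_closed_ball0 _ _ M) xM.
by apply/cvg_ex; exists p.
Qed.

Lemma ultra_bounded_cvgR (R : realType) (I : Type)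
    (U : set_system I) (x : I -> R) (M : R) :
  UltraFilter U -> (forall i, `|x i| <= M) -> cvg (x @ U).
Proof.
move=> UU xM.
have [|p _ xp] := ultra_compact_cvg (x := x) UU (@segment_compact _ (- M) M).
  by move=> i; rewrite /= in_itv/= -ler_norml.
by apply/cvg_ex; exists p.
Qed.

(** * Subgradients and convexity *)

Section bounded_subgradients.
Context {R : realType} {H : normedVectType R}.
Variable form : {dot H for idfun}.
Hypothesis hform : hilbert_norm form.

Lemma lipschitz_ball (f : H -> R)
    (flip : forall B : set H, bounded_set B -> [lipschitz f x | x in B]) (r : R) :
  exists2 L : R, 0 <= L & forall x y, `|x| <= r -> `|y| <= r ->
    `|f x - f y| <= L * `|x - y|.
Proof.
have /flip[M [_ HM]] : bounded_set [set x : H | `|x| <= r].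
  by exists r; split; [exact: num_real|move=> M rM x /= /le_trans; apply; exact: ltW].
exists (Num.max (M + 1) 0); first by rewrite le_max lexx orbT.
move=> x y xr yr; have MM : M < Num.max (M + 1) 0.
  by rewrite lt_max ltrDl ltr01.
exact: (HM _ MM (x, y)).
Qed.

(** The subgradient inequality tested at [x + p / |p|] reads [|p| <= f y - f x], and [y] lies at
    distance one from [x]; hence the radius [r + 1]. *)
Lemma subdiff_norm_le (f : H -> R) (L r : R) :
  (forall x y, `|x| <= r + 1 -> `|y| <= r + 1 -> `|f x - f y| <= L * `|x - y|) ->
  0 <= L -> forall x p, `|x| <= r -> subdiff form f x p -> `|p| <= L.
Proof.
move=> fL L0 x p xr sp; have [->|p0] := eqVneq p 0; first by rewrite normr0.
have np : 0 < `|p| by rewrite normr_gt0.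
pose d := `|p|^-1 *: p; pose y := x + d.
have dn : `|d| = 1 by rewrite normrZ normfV normr_id mulVf ?normr_eq0.
have := sp y; have -> : y - x = d by rewrite /y addrAC subrr add0r.
rewrite dotZr -hform expr2 mulKf ?gt_eqF// => py.
have yr : `|y| <= r + 1 by rewrite (le_trans (ler_normD _ _))// dn lerD2r.
have xr1 : `|x| <= r + 1 by rewrite (le_trans xr)// lerDl ler01.
have := fL y x yr xr1; have -> : y - x = d by rewrite /y addrAC subrr add0r.
by rewrite dn mulr1 => /ler_normlP[]; lra.
Qed.

End bounded_subgradients.

#[local] Instance ae_lebesgue_filter (R : realType) :
  Filter (nbhs (almost_everywhere (@lebesgue_measure R))) :=
  ae_filter_ringOfSetsType (@lebesgue_measure R).

Section convexity.
Context {R : realType} {H : normedVectType R}.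

Lemma convex_function_segment (f : H -> R) (t : R) (x y : H) :
  convex_function [set: H] f -> 0 <= t <= 1 ->
  f (x + t *: (y - x)) <= f x + t * (f y - f x).
Proof.
move=> fc /andP[t0 t1].
have := fc (Itv01 t0 t1) y x (mem_set I) (mem_set I).
rewrite convRE => h.
have {h} : f (t *: y + (1 - t) *: x) <= t * f y + (1 - t) * f x := h.
have -> : x + t *: (y - x) = t *: y + (1 - t) *: x.
  by rewrite scalerBr scalerBl scale1r addrCA.
by move=> /le_trans; apply; lra.
Qed.

Lemma convex_set_segment (K : set H) (t : R) (x y : H) :
  convex_set K -> 0 <= t <= 1 -> K x -> K y -> K (x + t *: (y - x)).
Proof.
move=> Kc /andP[t0 t1] Kx Ky.
have /set_mem := Kc y x (Itv01 t0 t1) (mem_set Ky) (mem_set Kx).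
move=> h; have {h} : K (t *: y + (1 - t) *: x) := h.
have -> // : x + t *: (y - x) = t *: y + (1 - t) *: x.
by rewrite scalerBr scalerBl scale1r addrCA.
Qed.

Lemma le0_le_small (a k : R) : (forall t, 0 < t <= 1 -> a <= t * k) -> a <= 0.
Proof.
move=> h; rewrite leNgt; apply/negP => a0.
have k0 : 0 < k.
  by have := h 1; rewrite ltr01 lexx mul1r => /(_ isT); exact: lt_le_trans.
(* At [t = a / (2 k)] the hypothesis becomes [a <= a / 2]; if this [t] exceeds [1], then [t = 1]
   gives [a <= k < a / 2]. *)
have [ak|ka] := leP (a / (2 * k)) 1; last first.
  have := h 1; rewrite ltr01 lexx mul1r => /(_ isT) ak.
  by move: ka; rewrite ltr_pdivlMr ?mulr_gt0// => ?; lra.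
have := h (a / (2 * k)); rewrite ak divr_gt0 ?mulr_gt0// => /(_ isT).
have -> : a / (2 * k) * k = a / 2 by field; rewrite gt_eqF.
lra.
Qed.

Variable form : {dot H for idfun}.
Hypothesis hform : hilbert_norm form.

(** Compare [y0] with [y0 + t (y - y0)], use convexity, divide by [t] and let [t] tend to [0].
    Taking [C] to be the whole space yields subgradients; taking [g = 0] and [C = K] yields normal
    vectors. *)
Lemma prox_variational (g : H -> R) (C : set H) (c : R) (v y0 : H) :
  (forall (x y : H) (t : R), 0 <= t <= 1 -> C x -> C y -> C (x + t *: (y - x)) /\
     g (x + t *: (y - x)) <= g x + t * (g y - g x)) ->
  C y0 ->
  (forall y, C y ->
     g y0 + c / 2 * `|v - y0| ^+ 2 <= g y + c / 2 * `|v - y| ^+ 2) ->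
  forall y, C y -> g y0 + form (c *: (v - y0)) (y - y0) <= g y.
Proof.
move=> cvx Cy0 ymin y Cy; rewrite -subr_le0.
apply: (@le0_le_small _ (`|c| / 2 * `|y - y0| ^+ 2)) => t /andP[t0 t1].
have t01 : 0 <= t <= 1 by rewrite (ltW t0).
have [Ct gt] := cvx y0 y t t01 Cy0 Cy.
have := ymin _ Ct.
have -> : v - (y0 + t *: (y - y0)) = (v - y0) + (- t) *: (y - y0).
  by rewrite opprD addrA scaleNr.
rewrite (normD2 hform (v - y0)) dotZr dotZl normrZ exprMn normrN (gtr0_norm t0).
set D := form _ _; set E := `|y - y0| ^+ 2; set A := `|v - y0| ^+ 2 => h.
have E0 : 0 <= E by rewrite sqr_ge0.
have h1 : t * (g y0 + c * D - g y) <= t * (t * (c / 2 * E)) by nra.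
have h2 : g y0 + c * D - g y <= t * (c / 2 * E) by rewrite -(ler_pM2l t0).
apply: le_trans h2 _; rewrite ler_pM2l// ler_wpM2r//.
by rewrite ler_wpM2r ?invr_ge0// ler_norm.
Qed.

End convexity.

(** * One step of the scheme: smoothed and penalised minimisation *)

Lemma minimizing_sequence (R : realType) T (D : set T) (Psi : T -> R) (b : R) :
  D !=set0 -> (forall w, D w -> b <= Psi w) ->
  exists m : nat -> T, forall k, D (m k) /\
    forall w, D w -> Psi (m k) <= Psi w + harmonic k.
Proof.
move=> [w0 Dw0] Psib.
have hi : has_inf (Psi @` D).
  split; first by exists (Psi w0); exists w0.
  by exists b => _ [w Dw <-]; exact: Psib.
have /choice[m Hm] : forall k : nat, exists w, D w /\
    forall w', D w' -> Psi w <= Psi w' + harmonic k.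
  move=> k; have [_ [w Dw <-] wk] := inf_adherent (@harmonic_gt0 R k) hi.
  exists w; split => // w' Dw'; apply: le_trans (ltW wk) _.
  by rewrite lerD2r; apply: ge_inf; [case: hi|exists w'].
by exists m.
Qed.

Section regularized_step.
Context {R : realType} {H : normedVectType R}.
Variable form : {dot H for idfun}.
Hypothesis hform : hilbert_norm form.
Variable (K : set H).
Hypotheses (Kclosed : closed K) (Kconvex : convex_set K).
Variables (q : nat) (f : 'I_q -> H -> R).
Hypotheses (q_gt0 : (0 < q)%N)
  (fconvex : forall i, convex_function [set: H] (f i))
  (fcont : forall i, continuous (f i))
  (fbound : forall i, has_lbound (range (f i))).
Variables (x : H) (h c : R).
Hypotheses (Kx : K x) (h0 : 0 < h) (c0 : 0 < c).

Local Notation state := (H * ('I_q -> H) * H)%type.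

(** A state is [(v, y, z)]: [v] is the sought point, [y i] the copy of it at which [f i] is
    evaluated, [z] the copy constrained to [K]. The parameter [c] is both the penalty and the
    sharpness of the soft maximum. *)
Let a (i : 'I_q) (w : state) : R :=
  f i (w.1.2 i) - f i x + c / 2 * `|w.1.1 - w.1.2 i| ^+ 2 +
  c / 2 * `|w.1.1 - w.2| ^+ 2 + (2 * h)^-1 * `|w.1.1 - x| ^+ 2.

(** Minimising this sum is minimising the soft maximum [ln Psi / c] of the [a i]. *)
Let Psi (w : state) := \sum_(i < q) expR (c * a i w).
Let D : set state := [set w | K w.2].

Let cvg_norm2 T (F : set_system T) {FF : Filter F} (g : T -> H) l :
  g @ F --> l -> `|g t| ^+ 2 @[t --> F] --> `|l| ^+ 2.
Proof.
move=> gl; rewrite expr2; under eq_fun do rewrite expr2.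
by apply: cvgM; exact: cvg_norm.
Qed.

Let a_cvg (F : set_system nat) (FF : ProperFilter F) (m : nat -> state) v y z :
  (m k).1.1 @[k --> F] --> v -> (forall i, (m k).1.2 i @[k --> F] --> y i) ->
  (m k).2 @[k --> F] --> z ->
  forall i, a i (m k) @[k --> F] --> a i (v, y, z).
Proof.
move=> mv my mz i; rewrite /a/=.
apply: cvgD; [apply: cvgD; [apply: cvgD|]|].
- apply: cvgB; last exact: cvg_cst.
  by apply: (@continuous_cvg _ _ _ _ _ _ (f i)); [exact: fcont|exact: my].
- by apply: cvgM; [exact: cvg_cst|apply: cvg_norm2; exact: cvgB].
- by apply: cvgM; [exact: cvg_cst|apply: cvg_norm2; exact: cvgB].
- apply: cvgM; [exact: cvg_cst|apply: cvg_norm2; apply: cvgB => //].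
  exact: cvg_cst.
Qed.

(** A crude bound free of square roots: [2 |y| <= |y|^2 + 1]. *)
Lemma norm_le_of_sqr (V : normedModType R) (d : R) (B : R) (y : V) :
  0 < d -> d * `|y| ^+ 2 <= B -> `|y| <= B / d + 1.
Proof.
move=> d0 dB; have h1 : `|y| ^+ 2 <= B / d by rewrite ler_pdivlMr// mulrC.
have h2 : 0 <= (`|y| - 1) ^+ 2 by rewrite sqr_ge0.
have h3 := normr_ge0 y.
nra.
Qed.

(** Direct method: along nearly minimising states the lower bounds of the [f i] control the three
    quadratic terms, so [v], the [y i] and [z] converge along an ultrafilter, and [Psi] is
    continuous. *)
Let minimizer_exists :
  exists2 w : state, D w & forall w', D w' -> Psi w <= Psi w'.
Proof.
have Dx : D (x, (fun=> x), x) by [].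
have Psi0 w : 0 <= Psi w by apply: sumr_ge0 => i _; exact: expR_ge0.
have [//|m Hm] := @minimizing_sequence R state D Psi 0 (ex_intro _ _ Dx).
have [U [UU ooU]] := ultraFilterLemma (@eventually_filter).
have ax i : a i (x, (fun=> x), x) = 0.
  by rewrite /a/= !subrr normr0 expr0n/= !mulr0 !addr0.
have Psix : Psi (x, (fun=> x), x) = q%:R.
  rewrite /Psi (eq_bigr (fun=> 1)) ?sumr_const ?card_ord// => i _.
  by rewrite ax mulr0 expR0.
(* Near-minimisers satisfy [Psi <= q + 1], because [Psi = q] at the trivial state; [1 + s <= exp s]
   turns this into a bound on each [a i]. *)
pose B i := (q%:R + 1) / c + f i x - inf (range (f i)).
have mB i k : c / 2 * `|(m k).1.1 - (m k).1.2 i| ^+ 2 +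
  c / 2 * `|(m k).1.1 - (m k).2| ^+ 2 + (2 * h)^-1 * `|(m k).1.1 - x| ^+ 2 <= B i.
  have : Psi (m k) <= q%:R + 1.
    have [_ /(_ _ Dx)] := Hm k; rewrite Psix => /le_trans; apply.
    rewrite lerD2l /harmonic/= invf_le1// ?ler1n//.
  rewrite {1}/Psi (bigD1 i)//= => P.
  have e1 : expR (c * a i (m k)) <= q%:R + 1.
    by apply: le_trans P; rewrite lerDl; apply: sumr_ge0 => j _; exact: expR_ge0.
  have e2 := expR_ge1Dx (c * a i (m k)).
  have e3 : a i (m k) <= (q%:R + 1) / c.
    by rewrite ler_pdivlMr// mulrC; lra.
  have e4 : inf (range (f i)) <= f i ((m k).1.2 i).
    by apply: ge_inf => //; exists ((m k).1.2 i).
  by move: e3; rewrite /a /B; lra.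
have i0 : 'I_q by exact: (Ordinal q_gt0).
have c2 : 0 < c / 2 by rewrite divr_gt0.
have h2 : 0 < (2 * h)^-1 by rewrite invr_gt0 mulr_gt0.
have bv k : `|(m k).1.1 - x| <= B i0 / (2 * h)^-1 + 1.
  apply: norm_le_of_sqr => //; apply: le_trans (mB i0 k).
  by rewrite lerDr addr_ge0// mulr_ge0 ?sqr_ge0// ltW.
have by_ i k : `|(m k).1.1 - (m k).1.2 i| <= B i / (c / 2) + 1.
  apply: norm_le_of_sqr => //; apply: le_trans (mB i k).
  by rewrite -addrA lerDl addr_ge0// mulr_ge0 ?sqr_ge0// ltW.
have bz k : `|(m k).1.1 - (m k).2| <= B i0 / (c / 2) + 1.
  apply: norm_le_of_sqr => //; apply: le_trans (mB i0 k).
  by rewrite addrAC lerDr addr_ge0// mulr_ge0 ?sqr_ge0// ltW.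
have /cvg_ex[v mv] : cvg ((m k).1.1 - x @[k --> U]) := ultra_bounded_cvg UU bv.
have hy : forall i, exists y : H, (m k).1.1 - (m k).1.2 i @[k --> U] --> y.
  by move=> i; apply/cvg_ex; exact: (ultra_bounded_cvg UU (by_ i)).
have [y my] := choice hy.
have /cvg_ex[z mz] : cvg ((m k).1.1 - (m k).2 @[k --> U]) := ultra_bounded_cvg UU bz.
have mv' : (m k).1.1 @[k --> U] --> v + x.
  have -> : (fun k => (m k).1.1) = (fun k => ((m k).1.1 - x) + x).
    by apply/funext => k; rewrite subrK.
  by apply: cvgD => //; exact: cvg_cst.
have my' i : (m k).1.2 i @[k --> U] --> v + x - y i.
  have -> : (fun k => (m k).1.2 i) = (fun k => (m k).1.1 - ((m k).1.1 - (m k).1.2 i)).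
    by apply/funext => k; rewrite opprB addrC subrK.
  by apply: cvgB => //; exact: my.
have mz' : (m k).2 @[k --> U] --> v + x - z.
  have -> : (fun k => (m k).2) = (fun k => (m k).1.1 - ((m k).1.1 - (m k).2)).
    by apply/funext => k; rewrite opprB addrC subrK.
  by apply: cvgB => //; exact: mz.
exists (v + x, (fun i => v + x - y i), v + x - z).
  rewrite /D/=; apply: (closed_cvg _ Kclosed _ _ mz').
  by apply: nearW => k; case: (Hm k).
move=> w Dw.
have PsiU : Psi (m k) @[k --> U] --> Psi (v + x, (fun i => v + x - y i), v + x - z).
  apply: cvg_sum => i _; apply: (@continuous_cvg _ _ _ _ _ _ (@expR R)); first exact: continuous_expR.
  by apply: cvgM; [exact: cvg_cst|exact: a_cvg].
apply: (ler_cvg_to PsiU (g := fun k => Psi w + harmonic k)).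
  rewrite -[X in _ --> X]addr0; apply: cvgD; first exact: cvg_cst.
  by apply: cvg_trans (@cvg_harmonic R); exact: cvg_app.
by apply: nearW => k; case: (Hm k) => _; exact.
Qed.

(** Optimality of the minimiser in [y i], in [z] and in [v] gives respectively the subgradients, the
    normal vector and the balance equation. The error [q / c] is the price of the soft maximum. *)
Lemma regularized_step : exists (v z : H) (y : 'I_q -> H) (theta : 'I_q -> R),
  [/\ unit_simplex theta, normal_cone form K z (c *: (v - z)),
      forall i, subdiff form (f i) (y i) (c *: (v - y i)),
      h^-1 *: (v - x) + c *: (v - z) +
        \sum_i theta i *: (c *: (v - y i)) = 0 &
      forall i, f i (y i) - f i x + h^-1 * `|v - x| ^+ 2 <= q%:R / c /\
        f i (y i) - f i x + c / 2 * `|v - y i| ^+ 2 + c / 2 * `|v - z| ^+ 2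
          <= q%:R / c].
Proof.
have [[[v y] z] Dw wmin] := minimizer_exists.
have Kz : K z := Dw.
set w : state := (v, y, z) in wmin *.
have Sgt0 w' : 0 < Psi w'.
  rewrite /Psi (bigD1 (Ordinal q_gt0))//= ltr_wpDr ?expR_gt0//.
  by apply: sumr_ge0 => j _; exact: expR_ge0.
(* Gibbs weights: the partial derivatives of the soft maximum with respect to the values [a i]. *)
pose theta i := expR (c * a i w) / Psi w.
have theta0 i : 0 < theta i by rewrite divr_gt0// expR_gt0.
have theta1 : \sum_i theta i = 1 by rewrite /theta -mulr_suml -/(Psi w) divff// gt_eqF.
have simplex : unit_simplex theta.
  split => // i; rewrite ltW//= -theta1 (bigD1 i)//= lerDl.
  by apply: sumr_ge0 => j _; exact: ltW.
have sd i : subdiff form (f i) (y i) (c *: (v - y i)).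
  move=> y'; apply: (prox_variational (C := setT) hform) => //.
    by move=> *; split => //; exact: convex_function_segment.
  move=> y1 _; pose w' : state := (v, (fun j => if j == i then y1 else y j), z).
  have := wmin w' Kz; rewrite /Psi (bigD1 i)//= [leRHS](bigD1 i)//=.
  rewrite [X in _ <= _ + X](eq_bigr (fun j => expR (c * a j w))); last first.
    by move=> j ji; rewrite /a/= (negbTE ji).
  rewrite lerD2r ler_expR ler_pM2l// /a/= eqxx; lra.
have nc : normal_cone form K z (c *: (v - z)).
  split => // z' Kz'; rewrite -[leLHS]add0r.
  apply: (@prox_variational _ _ _ hform (fun=> 0) K) => //.
    move=> *; split; last by rewrite subrr mulr0 addr0.
    exact: convex_set_segment.
  move=> z1 Kz1; rewrite !add0r; pose w' : state := (v, y, z1).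
  rewrite leNgt; apply/negP => lt1.
  (* [z] enters every [a i] through the same penalty, so moving it closer to [v] lowers all terms at
     once. *)
  have : Psi w' < Psi w.
    have lta i : expR (c * a i w') < expR (c * a i w).
      by rewrite ltr_expR ltr_pM2l// /a/=; lra.
    rewrite /Psi (bigD1 (Ordinal q_gt0))//= [ltRHS](bigD1 (Ordinal q_gt0))//=.
    by rewrite ltr_leD//; apply: ler_sum => i _; exact: ltW.
  by rewrite ltNge wmin.
(* Gradient of [a i] in [v]; [kap] is the coefficient of the quadratic remainder. *)
pose g i := c *: (v - y i) + c *: (v - z) + h^-1 *: (v - x).
pose kap := c + (2 * h)^-1.
have aE i d t : a i (v + t *: d, y, z) =
    a i w + t * (form (g i) d + t * (kap * `|d| ^+ 2)).
  have sh u : v + t *: d - u = (v - u) + t *: d by rewrite addrAC.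
  rewrite /a/= !sh !(normD2 hform (v - _)) !dotE !normrZ !exprMn real_normK ?num_real//.
  rewrite /kap; field; rewrite gt_eqF//=.
(* The directional derivative of [Psi] is nonnegative at a minimum. With [t = 1 / (k + 1)], the
   inequality [1 + s <= exp s] bounds the increment of [Psi] by [c t] times [s k], and [s k] tends
   to the claimed sum. *)
have opt d : 0 <= \sum_i expR (c * a i w) * form (g i) d.
  pose s (k : nat) : R := \sum_i expR (c * (a i w +
      harmonic k * (form (g i) d + harmonic k * (kap * `|d| ^+ 2)))) *
      (form (g i) d + harmonic k * (kap * `|d| ^+ 2)).
  have s0 (k : nat) : 0 <= s k.
    rewrite /s.
    set t := harmonic k; have t0 : 0 < t := @harmonic_gt0 R k.
    have := wmin (v + t *: d, y, z) Kz; rewrite /Psi -subr_ge0 -sumrB => P.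
    rewrite -(pmulr_rge0 _ (mulr_gt0 c0 t0)); apply: le_trans P _.
    rewrite mulr_sumr; apply: ler_sum => i _; rewrite aE.
    set E := form (g i) d + _; set A := a i w.
    have := expR_ge1Dx (- (c * t * E)) => e1.
    have -> : expR (c * A) = expR (c * (A + t * E)) * expR (- (c * t * E)).
      by rewrite -expRD; congr expR; ring.
    have := expR_gt0 (c * (A + t * E)); set e := expR (c * _) => e0.
    nra.
  have hc : (@harmonic R) k @[k --> \oo] --> (0 : R) := @cvg_harmonic R.
  suff sc : s @ \oo --> \sum_i expR (c * a i w) * form (g i) d.
    by apply: (cvgr_to_ge sc); exact: nearW.
  apply: cvg_sum => i _.
  have h1 : form (g i) d + harmonic k * (kap * `|d| ^+ 2) @[k --> \oo]
      --> form (g i) d.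
    rewrite -[X in _ --> X]addr0; apply: cvgD; first exact: cvg_cst.
    by rewrite -(mul0r (kap * `|d| ^+ 2)); apply: cvgM => //; exact: cvg_cst.
  apply: cvgM => //; apply: (@continuous_cvg _ _ _ _ _ _ (@expR R)); first exact: continuous_expR.
  apply: cvgM; first exact: cvg_cst.
  rewrite -[X in _ --> X]addr0; apply: cvgD; first exact: cvg_cst.
  by rewrite -(mul0r (form (g i) d)); exact: cvgM.
have gsum : \sum_i theta i *: g i =
    h^-1 *: (v - x) + c *: (v - z) + \sum_i theta i *: (c *: (v - y i)).
  under eq_bigr do rewrite /g -addrA scalerDr.
  rewrite big_split/= addrC -scaler_suml theta1 scale1r.
  by rewrite [X in X + _ = _]addrC.
have gsum0 : \sum_i theta i *: g i = 0.
  (* The direction [- s] forces [|s|^2 <= 0]. *)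
  set s := \sum_i _; have := opt (- s).
  under eq_bigr do rewrite dotNr mulrN.
  rewrite sumrN oppr_ge0 -(pmulr_rle0 _ (x := (Psi w)^-1)) ?invr_gt0// mulr_sumr.
  have -> : \sum_(i < q) (Psi w)^-1 * (expR (c * a i w) * form (g i) s) = form s s.
    rewrite {3}/s dot_suml; apply: eq_bigr => i _; rewrite dotZl /theta; ring.
  rewrite -hform => s2; apply/eqP; rewrite -normr_eq0.
  by have := sqr_ge0 `|s|; rewrite -sqrf_eq0 eq_le s2 => ->.
exists v, z, y, theta; split => //; first by rewrite -gsum.
(* The subgradient inequality at [y i] and the normal cone inequality at [z] are both tested at the
   previous point [x], which lies in [K]. *)
have aw i : a i w <= form (g i) (v - x) - h^-1 * `|v - x| ^+ 2 + (2 * h)^-1 * `|v - x| ^+ 2.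
  have e u : form (c *: (v - u)) (x - u) =
      c * `|v - u| ^+ 2 - form (c *: (v - u)) (v - x).
    have -> : x - u = (v - u) - (v - x) by rewrite opprB [RHS]addrC addrA subrK.
    by rewrite dotDr dotNr dotZl -hform.
  have := sd i x; have [_ /(_ x Kx)] := nc.
  rewrite !e /g !dotDl [form (h^-1 *: _) _]dotZl -hform /a/=.
  have A0 : 0 <= c * `|v - y i| ^+ 2 by rewrite mulr_ge0 ?sqr_ge0// ltW.
  have B0 : 0 <= c * `|v - z| ^+ 2 by rewrite mulr_ge0 ?sqr_ge0// ltW.
  lra.
(* In the weighted average the linear terms vanish by [gsum0]. *)
have sa : \sum_i theta i * a i w <= - (2 * h)^-1 * `|v - x| ^+ 2.
  pose b := - (2 * h)^-1 * `|v - x| ^+ 2.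
  have : \sum_i theta i * a i w <= \sum_i theta i * (form (g i) (v - x) + b).
    apply: ler_sum => i _; rewrite ler_pM2l//; apply: le_trans (aw i) _.
    rewrite -addrA lerD2l /b le_eqVlt; apply/orP; left; apply/eqP; field.
    by rewrite gt_eqF.
  move/le_trans; apply; under eq_bigr do rewrite mulrDr.
  rewrite big_split/= -mulr_suml theta1 mul1r.
  have -> : \sum_i theta i * form (g i) (v - x) = form (\sum_i theta i *: g i) (v - x).
    by rewrite dot_suml; apply: eq_bigr => i _; rewrite dotZl.
  by rewrite gsum0 dot0l add0r.
set abar := \sum_i _ in sa.
(* Each term [exp (c (a i - abar)) (1 + c (abar - a i))] is at most [1], and these terms sum to
   [exp (- c abar) Psi]. Hence [exp (c (a j - abar)) <= q]. *)
have ab j : a j w <= abar + q%:R / c.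
  have Ssum : \sum_i expR (c * a i w) * a i w = Psi w * abar.
    rewrite /abar mulr_sumr; apply: eq_bigr => i _.
    by rewrite /theta mulrA [Psi w * _]mulrC divfK// gt_eqF.
  have S1 : expR (- (c * abar)) * Psi w <= q%:R.
    have -> : expR (- (c * abar)) * Psi w = \sum_i
        expR (- (c * abar)) * (expR (c * a i w) * (1 + c * (abar - a i w))).
      rewrite -mulr_sumr; congr (_ * _).
      under eq_bigr do rewrite mulrDr mulr1 mulrBr mulrBr.
      rewrite big_split/= sumrB -mulr_suml -/(Psi w).
      under [in X in _ - X]eq_bigr do rewrite mulrCA.
      by rewrite -mulr_sumr Ssum mulrCA subrr addr0.
    rewrite -[q in leRHS]card_ord -sumr_const; apply: ler_sum => i _.
    have := expR_ge1Dx (c * (abar - a i w)).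
    move=> /(ler_wpM2l (expR_ge0 (c * a i w)))/(ler_wpM2l (expR_ge0 (- (c * abar)))).
    move=> /le_trans; apply; rewrite -!expRD -[leRHS]expR0 ler_expR le_eqVlt.
    by apply/orP; left; apply/eqP; ring.
  have S2 : expR (c * a j w) <= Psi w.
    rewrite /Psi (bigD1 j)//= lerDl.
    by apply: sumr_ge0 => i _; exact: expR_ge0.
  have := expR_ge1Dx (c * a j w - c * abar).
  rewrite addrC -lerBrDr => e1.
  have e2 : expR (c * a j w - c * abar) <= q%:R.
    by rewrite addrC expRD; apply: le_trans S1; rewrite ler_wpM2l// expR_ge0.
  rewrite -lerBlDl ler_pdivlMr//; lra.
move=> j; have := ab j; rewrite /a/= => abj.
have hx : 0 <= (2 * h)^-1 * `|v - x| ^+ 2.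
  by rewrite mulr_ge0 ?sqr_ge0// invr_ge0 ltW// mulr_gt0.
have cx u : 0 <= c / 2 * `|v - u| ^+ 2.
  by rewrite mulr_ge0 ?sqr_ge0// divr_ge0// ltW.
have := cx (y j); have := cx z.
(* One half of [h^-1 |v - x|^2] comes from [a j] itself, the other from [sa]. *)
have hE : h^-1 = 2 * (2 * h)^-1 by field; rewrite gt_eqF.
rewrite hE; split; lra.
Qed.

End regularized_step.

(** * One step of the scheme: removal of the penalties *)

Section implicit_step.
Context {R : realType} {H : normedVectType R}.
Variable form : {dot H for idfun}.
Hypothesis hform : hilbert_norm form.
Variable (K : set H).
Hypotheses (Kclosed : closed K) (Kconvex : convex_set K).
Variables (q : nat) (f : 'I_q -> H -> R).
Hypotheses (q_gt0 : (0 < q)%N)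
  (fconvex : forall i, convex_function [set: H] (f i))
  (fcont : forall i, continuous (f i))
  (flip : forall i (B : set H), bounded_set B -> [lipschitz f i x | x in B])
  (fbound : forall i, has_lbound (range (f i))).

Lemma cvg0_of_sqr_le (U : set_system nat) (FU : ProperFilter U)
    (ooU : \oo `<=` U) (d : nat -> H) (l : H) (B : R) :
  d @ U --> l -> (forall k, k.+1%:R / 2 * `|d k| ^+ 2 <= B) -> l = 0.
Proof.
move=> dl dB; apply/eqP; rewrite -normr_eq0 -sqrf_eq0 eq_le sqr_ge0 andbT.
have h1 : `|d k| ^+ 2 @[k --> U] --> `|l| ^+ 2.
  rewrite expr2; under eq_fun do rewrite expr2.
  by apply: cvgM; exact: cvg_norm.
have h2 : 2 * B * harmonic k @[k --> U] --> (0 : R).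
  rewrite -(mulr0 (2 * B)); apply: cvgM; first exact: cvg_cst.
  by apply: cvg_trans (@cvg_harmonic R); exact: cvg_app.
apply: (ler_cvg_to h1 h2); apply: nearW => k.
rewrite /harmonic ler_pdivlMr ?ltr0n//; have := dB k; lra.
Qed.

(** Take the penalty [c = k + 1] and let [k] tend to infinity along an ultrafilter. The copies merge
    into one point [x'], the multipliers stay bounded, and the conditions defining normal vectors
    and subgradients are closed. *)
Lemma implicit_step (x : H) (h : R) : K x -> 0 < h ->
  exists (x' eta : H) (theta : 'I_q -> R) (p : 'I_q -> H),
  [/\ unit_simplex theta, normal_cone form K x' eta,
      forall i, subdiff form (f i) x' (p i),
      x' = x - h *: (eta + \sum_i theta i *: p i) &
      forall i, f i x' - f i x + h^-1 * `|x' - x| ^+ 2 <= 0].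
Proof.
move=> Kx h0.
have /choice[W HW] : forall k : nat, exists w : (H * H) * ('I_q -> H) * ('I_q -> R),
  [/\ unit_simplex w.2, normal_cone form K w.1.1.2 (k.+1%:R *: (w.1.1.1 - w.1.1.2)),
      forall i, subdiff form (f i) (w.1.2 i) (k.+1%:R *: (w.1.1.1 - w.1.2 i)),
      h^-1 *: (w.1.1.1 - x) + k.+1%:R *: (w.1.1.1 - w.1.1.2) +
        \sum_i w.2 i *: (k.+1%:R *: (w.1.1.1 - w.1.2 i)) = 0 &
      forall i, f i (w.1.2 i) - f i x + h^-1 * `|w.1.1.1 - x| ^+ 2 <= q%:R / k.+1%:R /\
        f i (w.1.2 i) - f i x + k.+1%:R / 2 * `|w.1.1.1 - w.1.2 i| ^+ 2
          + k.+1%:R / 2 * `|w.1.1.1 - w.1.1.2| ^+ 2 <= q%:R / k.+1%:R].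
  move=> k; have [v [z [y [theta hw]]]] := regularized_step hform Kclosed Kconvex
    q_gt0 fconvex fcont fbound Kx h0 (ltr0Sn R k).
  by exists (v, z, y, theta).
pose v k := (W k).1.1.1; pose z k := (W k).1.1.2; pose y k := (W k).1.2.
pose th k := (W k).2; pose c (k : nat) : R := k.+1%:R.
have c1 k : 1 <= c k by rewrite ler1n.
have c0 k : 0 < c k by rewrite ltr0Sn.
have {HW} HW k : [/\ unit_simplex (th k), normal_cone form K (z k) (c k *: (v k - z k)),
      forall i, subdiff form (f i) (y k i) (c k *: (v k - y k i)),
      h^-1 *: (v k - x) + c k *: (v k - z k) +
        \sum_i th k i *: (c k *: (v k - y k i)) = 0 &
      forall i, f i (y k i) - f i x + h^-1 * `|v k - x| ^+ 2 <= q%:R / c k /\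
        f i (y k i) - f i x + c k / 2 * `|v k - y k i| ^+ 2
          + c k / 2 * `|v k - z k| ^+ 2 <= q%:R / c k] := HW k.
have [U [UU ooU]] := ultraFilterLemma (@eventually_filter).
pose B i := q%:R + f i x - inf (range (f i)).
have fB i u : inf (range (f i)) <= f i u by apply: ge_inf => //; exists u.
have qc k : q%:R / c k <= q%:R.
  by rewrite ler_pdivrMr// ler_peMr// ler0n.
have arith (a b g Q M X Y : R) : a - b + X + Y <= Q -> 0 <= Y -> g <= a ->
  Q <= M -> X <= M + b - g by lra.
have vB i k : h^-1 * `|v k - x| ^+ 2 <= B i.
  by have [_ _ _ _ /(_ i)[+ _]] := HW k; rewrite -[leLHS]addr0 => /arith; apply.
have sq0 k (u : H) : 0 <= c k / 2 * `|u| ^+ 2.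
  by rewrite mulr_ge0 ?sqr_ge0// divr_ge0// ltW.
have yB i k : c k / 2 * `|v k - y k i| ^+ 2 <= B i.
  by have [_ _ _ _ /(_ i)[_]] := HW k => /arith; apply.
have zB i k : c k / 2 * `|v k - z k| ^+ 2 <= B i.
  by have [_ _ _ _ /(_ i)[_]] := HW k; rewrite addrAC => /arith; apply.
have i0 : 'I_q by exact: (Ordinal q_gt0).
(* Since [c k >= 1], the penalty bounds hold uniformly in [k]. *)
have half (u : H) k b : c k / 2 * `|u| ^+ 2 <= b -> `|u| <= b / 2^-1 + 1.
  move=> ub; apply: norm_le_of_sqr; first by rewrite invr_gt0.
  apply: le_trans ub; rewrite ler_wpM2r ?sqr_ge0//.
  by rewrite ler_peMl// invr_ge0.
pose Bv := B i0 / h^-1 + 1.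
have vb k : `|v k - x| <= Bv by apply: norm_le_of_sqr; rewrite ?invr_gt0.
pose rho i := `|x| + Bv + (B i / 2^-1 + 1).
have yb i k : `|y k i| <= rho i.
  have -> : y k i = x + (v k - x) - (v k - y k i).
    by rewrite [x + _]addrC subrK opprB addrC subrK.
  rewrite (le_trans (ler_normB _ _))// lerD ?(half _ _ _ (yB i k))//.
  by rewrite (le_trans (ler_normD _ _))// lerD2l.
have /choice[L HL] : forall i, exists L : R, 0 <= L /\
    forall k, `|c k *: (v k - y k i)| <= L.
  move=> i; have [L L0 HL] := lipschitz_ball (@flip i) (rho i + 1).
  exists L; split => // k; have [_ _ /(_ i) s _ _] := HW k.
  exact: (subdiff_norm_le hform HL L0 (yb i k) s).
have thb k i : `|th k i| <= 1.
  by have [[+ _] _ _ _ _] := HW k => /(_ i)/andP[t0 t1]; rewrite ger0_norm.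
(* The normal multiplier has no bound of its own; the balance equation expresses it through bounded
   quantities. *)
have eE k : c k *: (v k - z k) =
    - (h^-1 *: (v k - x) + \sum_i th k i *: (c k *: (v k - y k i))).
  have [_ _ _ e _] := HW k; apply/eqP; rewrite -addr_eq0 addrC addrAC.
  by rewrite e.
have eb k : `|c k *: (v k - z k)| <= h^-1 * Bv + \sum_i L i.
  rewrite eE normrN (le_trans (ler_normD _ _))// lerD//.
    by rewrite normrZ gtr0_norm ?invr_gt0// ler_pM2l ?invr_gt0.
  rewrite (le_trans (ler_norm_sum _ _ _))// ler_sum// => i _.
  rewrite normrZ -[leRHS]mul1r ler_pM//.
  by have [_] := HL i; exact.
have /cvg_ex[l vl] : cvg (v k - x @[k --> U]) := ultra_bounded_cvg UU vb.
have {vl} vl : v @ U --> l + x.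
  have -> : v = (fun k => (v k - x) + x) by apply/funext => k; rewrite subrK.
  by apply: cvgD => //; exact: cvg_cst.
set x' := l + x in vl; exists x'.
have zl : z @ U --> x'.
  have /cvg_ex[d dl] : cvg (v k - z k @[k --> U]).
    by apply: ultra_bounded_cvg => k; exact: half (zB i0 k).
  have d0 := cvg0_of_sqr_le _ ooU dl (zB i0).
  have -> : z = (fun k => v k - (v k - z k)).
    by apply/funext => k; rewrite opprB addrC subrK.
  by rewrite -[x']subr0 -d0; exact: cvgB.
have yl i : y k i @[k --> U] --> x'.
  have /cvg_ex[d dl] : cvg (v k - y k i @[k --> U]).
    by apply: ultra_bounded_cvg => k; exact: half (yB i k).
  have d0 := cvg0_of_sqr_le _ ooU dl (yB i).
  have -> : (fun k => y k i) = (fun k => v k - (v k - y k i)).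
    by apply/funext => k; rewrite opprB addrC subrK.
  by rewrite -[x']subr0 -d0; exact: cvgB.
have /cvg_ex[eta etal] : cvg (c k *: (v k - z k) @[k --> U]) := ultra_bounded_cvg UU eb.
have hth : forall i, exists t : R, th k i @[k --> U] --> t.
  by move=> i; apply/cvg_ex; apply: ultra_bounded_cvgR => k; exact: thb.
have [theta thl] := choice hth.
have hp : forall i, exists t : H, c k *: (v k - y k i) @[k --> U] --> t.
  by move=> i; apply/cvg_ex; apply: ultra_bounded_cvg => k; have [_] := HL i; exact.
have [p pl] := choice hp.
have fyl i : f i (y k i) @[k --> U] --> f i x'.
  by apply: (@continuous_cvg _ _ _ _ _ _ (f i)); [exact: fcont|exact: yl].
exists eta, theta, p; split.
- split=> [i|].
    apply/andP; split.
      apply: (cvgr_to_ge (thl i)); apply: nearW => k.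
      by have [[/(_ i)/andP[]]] := HW k.
    apply: (cvgr_to_le (thl i)); apply: nearW => k.
    by have [[/(_ i)/andP[]]] := HW k.
  have s1 : \sum_i th k i @[k --> U] --> \sum_i theta i.
    by apply: cvg_sum => i _; exact: thl.
  apply/eqP; rewrite eq_le; apply/andP; split.
    by apply: (cvgr_to_le s1); apply: nearW => k; have [[_ ->]] := HW k.
  by apply: (cvgr_to_ge s1); apply: nearW => k; have [[_ ->]] := HW k.
- split.
    by apply: (closed_cvg _ Kclosed _ _ zl); apply: nearW => k; have [_ []] := HW k.
  move=> u Ku; have el : form (c k *: (v k - z k)) (u - z k) @[k --> U] --> form eta (u - x').
    by apply: (cvg_dot hform) => //; apply: cvgB => //; exact: cvg_cst.
  apply: (cvgr_to_le el); apply: nearW => k.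
  by have [_ [_ /(_ u Ku)]] := HW k.
- move=> i u; have el : f i (y k i) + form (c k *: (v k - y k i)) (u - y k i) @[k --> U]
     --> f i x' + form (p i) (u - x').
    apply: cvgD => //; apply: (cvg_dot hform); first exact: pl.
    by apply: cvgB => //; exact: cvg_cst.
  apply: (cvgr_to_le el); apply: nearW => k.
  by have [_ _ /(_ i u)] := HW k.
- have el : h^-1 *: (v k - x) + c k *: (v k - z k) +
        \sum_i th k i *: (c k *: (v k - y k i)) @[k --> U] -->
        h^-1 *: (x' - x) + eta + \sum_i theta i *: p i.
    apply: cvgD; last by apply: cvg_sum => i _; apply: cvgZ; [exact: thl|exact: pl].
    apply: cvgD => //; apply: cvgZl_tmp; apply: cvgB => //; exact: cvg_cst.
  have : h^-1 *: (x' - x) + eta + \sum_i theta i *: p i = 0.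
    apply: (cvg_unique _ el); first exact: norm_hausdorff.
    rewrite [X in X @ U](_ : _ = fun=> 0); first exact: cvg_cst.
    by apply/funext => k; have [_ _ _ ->] := HW k.
  rewrite -addrA => /eqP; rewrite addr_eq0 => /eqP e.
  have -> : eta + \sum_i theta i *: p i = - (h^-1 *: (x' - x)) by rewrite e opprK.
  by rewrite scalerN scalerA divff ?gt_eqF// scale1r opprK addrC subrK.
- move=> i; have el : f i (y k i) - f i x + h^-1 * `|v k - x| ^+ 2 @[k --> U] -->
      f i x' - f i x + h^-1 * `|x' - x| ^+ 2.
    apply: cvgD; first by apply: cvgB => //; exact: cvg_cst.
    apply: cvgM; first exact: cvg_cst.
    rewrite expr2; under eq_fun do rewrite expr2.
    by apply: cvgM; apply: cvg_norm; apply: cvgB => //; exact: cvg_cst.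
  apply: (ler_cvg_to (g := fun k => q%:R * harmonic k) el).
    rewrite -(mulr0 q%:R); apply: cvgM; first exact: cvg_cst.
    by apply: cvg_trans (@cvg_harmonic R); exact: cvg_app.
  by apply: nearW => k; have [_ _ _ _ /(_ i)[]] := HW k.
Qed.

End implicit_step.

(** * Lipschitz curves as integrals of their derivatives *)

Definition locally_lipschitz (R : realType) (V : normedModType R) (F : R -> V) :=
  forall T, 0 < T -> exists2 M, 0 <= M & forall s t : R,
    0 <= s -> s <= t -> t <= T -> `|F t - F s| <= M * (t - s).

Section lipschitz_ftc.
Context {R : realType}.
Local Notation mu := (@lebesgue_measure R).

Lemma lebesgue_stieltjes_measure_itv_oc (F : cumulative R R) (a b : R) : a <= b ->
  lebesgue_stieltjes_measure F `]a, b]%classic = (F b - F a)%:E.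
Proof.
move=> ab; rewrite /lebesgue_stieltjes_measure/= /measure_extension/=.
rewrite measurable_mu_extE//; last exact: is_ocitv.
exact: wlength_itv_bnd.
Qed.

(** A null set is covered by half-open intervals of small total length, and on each of them the
    Stieltjes length is at most [L] times the length. *)
Lemma lipschitz_lebesgue_stieltjes_dominates (F : cumulative R R) (L : R) :
  0 <= L -> (forall x y, x <= y -> F y - F x <= L * (y - x)) ->
  forall A : set R, mu A = 0%E -> lebesgue_stieltjes_measure F A = 0%E.
Proof.
move=> L0 FL A A0.
have wL (X : set R) : ocitv X -> (wlength F X <= L%:E * wlength idfun X)%E.
  move=> /ocitvP[->|[[a b] /= ab ->]].
    by rewrite !wlength0 mule0.
  rewrite (wlength_itv_bnd F _ _ (ltW ab)) (wlength_itv_bnd idfun _ _ (ltW ab)).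
  by rewrite -EFinM lee_fin FL// ltW.
apply/eqP; rewrite eq_le measure_ge0 andbT.
apply/lee_addgt0Pr => e e0; rewrite add0e.
(* [L + 1] instead of [L] keeps the quotient meaningful when [L = 0]. *)
have : (mu A < (e / (L + 1))%:E)%E by rewrite A0 lte_fin divr_gt0// ltr_wpDl.
rewrite /lebesgue_measure/lebesgue_stieltjes_measure/= /measure_extension/mu_ext.
move=> /ereal_inf_lt[_ [B [mB AB] <-]] Be.
apply: ge_ereal_inf; exists (\sum_(0 <= k <oo) wlength F (B k))%E.
  by exists B.
have h : (\sum_(0 <= k <oo) wlength F (B k) <=
  \sum_(0 <= k <oo) (L%:E * wlength idfun (B k)))%E.
  by apply: lee_nneseries => [k _ _|k _]; [exact: wlength_ge0|exact: (wL _ (mB k))].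
apply: le_trans h _; rewrite nneseriesZl//.
apply: (@le_trans _ _ (L%:E * (e / (L + 1))%:E)%E).
  by apply: lee_wpmul2l; [rewrite lee_fin|exact: (ltW Be)].
rewrite -EFinM lee_fin mulrCA ger_pMr// ler_pdivrMr ?mul1r ?lerDl// ltr_wpDl//.
Qed.

(** The density is the Radon-Nikodym derivative of the Stieltjes measure of [F], restricted to []0,
    T]] so as to be finite. *)
Lemma monotone_lipschitz_density (F : R -> R) (L T : R) : 0 <= L -> 0 < T ->
  {homo F : x y / x <= y} ->
  (forall x y, x <= y -> F y - F x <= L * (y - x)) ->
  exists2 g : R -> R, mu.-integrable setT (EFin \o g) &
    forall t, 0 <= t <= T -> F t - F 0 = \int[mu]_(x in `]0, t]) g x.
Proof.
move=> L0 T0 Fnd FL.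
have Fc : continuous F.
  move=> x; apply/cvgrPdist_le => e e0; near=> y.
  apply: (@le_trans _ _ (L * `|x - y|)).
    have [xy|/ltW yx] := leP x y.
      by rewrite distrC [X in _ * X]distrC !ger0_norm ?subr_ge0 ?Fnd ?FL.
    by rewrite !ger0_norm ?subr_ge0 ?Fnd ?FL.
  have : `|x - y| <= e / (L + 1).
    near: y; apply: cvgr_dist_le; first exact: cvg_id.
    by rewrite divr_gt0// ltr_wpDl.
  rewrite ler_pdivlMr ?ltr_wpDl// => h; apply: le_trans h.
  by rewrite mulrC ler_wpM2l// lerDl.
pose FC : cumulative R R :=
  HB.pack F (isCumulative.Build R _ R F Fnd (right_continuousW Fc)).
pose D : set (measurableTypeR R) := `]0, T]%classic.
have mD : measurable D by exact: measurable_itv.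
have Dfin : (lebesgue_stieltjes_measure FC D < +oo)%E.
  by rewrite lebesgue_stieltjes_measure_itv_oc ?ltW// ltry.
pose nu : {finite_measure set (measurableTypeR R) -> \bar R} := mfrestr mD Dfin.
have nuE A : nu A = lebesgue_stieltjes_measure FC (A `&` D) by [].
have nu_mu : nu `<< mu.
  apply/null_content_dominatesP => A mA A0; rewrite nuE.
  apply: (lipschitz_lebesgue_stieltjes_dominates L0) => //.
  apply: (subset_measure0 (mu := mu) _ mA _ A0); first exact: measurableI.
  exact: subIsetl.
have [g [g0 gfin gint gE]] := radon_nikodym_sigma_finite nu_mu.
have gf : EFin \o (fine \o g) = g by apply/funext => x /=; rewrite fineK.
exists (fine \o g); first by rewrite gf.
move=> t /andP[t0 tT].
have -> : \int[mu]_(x in `]0, t]) (fine \o g) x = fine (nu `]0, t]%classic).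
  rewrite gE; last exact: measurable_itv.
  by congr fine; apply: eq_integral => x _ /=; rewrite fineK.
rewrite nuE (_ : _ `&` _ = `]0, t]%classic).
  by rewrite lebesgue_stieltjes_measure_itv_oc.
rewrite /D; apply/seteqP; split => [x [] //|x /=]; rewrite !in_itv/= => /andP[-> xt].
by rewrite xt (le_trans xt).
Unshelve. all: by end_near. Qed.

(** [C t + M t] is nondecreasing, so the monotone case applies, and [M] is subtracted from the
    density. Lebesgue differentiation identifies the result with the derivative. *)
Lemma lipschitz_density_itv (C : R -> R) (M T : R) : 0 <= M -> 0 < T ->
  (forall s t, 0 <= s -> s <= t -> t <= T -> `|C t - C s| <= M * (t - s)) ->
  exists g : R -> R, [/\ mu.-integrable setT (EFin \o g),
    forall t, 0 <= t <= T -> C t = C 0 + \int[mu]_(x in `[0, t]) g x &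
    {ae mu, forall t : R, 0 < t < T -> derivable C t 1 /\ derive1 C t = g t}].
Proof.
move=> M0 T0 CM.
(* Clamping to [[0, T]] extends the curve to the whole line with the same Lipschitz constant. *)
pose cl (t : R) := Num.max 0 (Num.min t T).
have cl_ge0 t : 0 <= cl t by rewrite le_max lexx.
have cl_leT t : cl t <= T by rewrite ge_max (ltW T0) ge_min lexx orbT.
have clE (t : R) : 0 <= t <= T -> cl t = t.
  by move=> /andP[t0 tT]; rewrite /cl min_l// max_r.
have cl_homo (x y : R) : x <= y -> cl x <= cl y.
  move=> xy; rewrite /cl /Num.max /Num.min.
  case: (ltP x T) => ?; case: (ltP y T) => ?;
    (do ?[case: ltP => ?]); lra.
have cl_lip (x y : R) : x <= y -> cl y - cl x <= y - x.
  move=> xy; rewrite /cl /Num.max /Num.min.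
  case: (ltP x T) => ?; case: (ltP y T) => ?;
    (do ?[case: ltP => ?]); lra.
pose F t := C (cl t) + M * cl t.
have FC (x y : R) : x <= y -> `|C (cl y) - C (cl x)| <= M * (cl y - cl x).
  by move=> xy; apply: CM => //; exact: cl_homo.
have Fnd : {homo F : x y / x <= y}.
  by move=> x y xy; have /ler_normlP[] := FC x y xy; rewrite /F; lra.
have Flip (x y : R) : x <= y -> F y - F x <= (2 * M) * (y - x).
  move=> xy; have /ler_normlP[_] := FC x y xy.
  have := ler_wpM2l M0 (cl_lip _ _ xy); rewrite /F; lra.
have M2 : 0 <= 2 * M by rewrite mulr_ge0.
have [g0 ig0 g0E] := monotone_lipschitz_density M2 T0 Fnd Flip.
pose D : set (measurableTypeR R) := `[0, T]%classic.
have mD : measurable D by exact: measurable_itv.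
pose g := (fun x => g0 x - M) \_ D.
have icst (S : set (measurableTypeR R)) : measurable S -> (mu S < +oo)%E ->
    mu.-integrable S (EFin \o (cst M)).
  move=> mS Sfin; apply: measurable_bounded_integrable => //.
  by exists `|M|; split; [exact: num_real|move=> ? /ltW + ? ?; exact].
have itv_fin (a b : R) (p r : bool) :
    (mu [set` Interval (BSide p a) (BSide r b)] < +oo)%E.
  by rewrite lebesgue_measure_itv /=; case: ifP => // _; rewrite ltry.
have ig : mu.-integrable setT (EFin \o g).
  have : mu.-integrable D (fun x => ((g0 x)%:E - M%:E)%E).
    apply: integrableB => //; first exact: (integrableS measurableT).
    by apply: icst => //; exact: itv_fin.
  by move=> /integrable_mkcond; rewrite /g restrict_EFin; exact.
have gE (t : R) : 0 <= t <= T -> \int[mu]_(x in `[0, t]) g x = C t - C 0.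
  move=> tT; have /andP[t0 tT'] := tT.
  have m0t : measurable (`[0, t]%classic : set (measurableTypeR R)).
    exact: measurable_itv.
  transitivity (\int[mu]_(x in `[0, t]) (g0 x - cst M x)).
    apply: eq_Rintegral => x; rewrite inE/= in_itv/= => /andP[x0 xt].
    by rewrite /g patchE ifT// inE /D/= in_itv/= x0 (le_trans xt).
  rewrite RintegralB//; last 2 first.
    by apply: integrableS ig0.
    by apply: icst => //; exact: itv_fin.
  rewrite Rintegral_cst// -Rintegral_itv_obnd_cbnd; last first.
    by apply: integrableS ig0 => //; exact: measurable_itv.
  have mt : fine (mu `[0%R, t]%classic) = t.
    rewrite lebesgue_measure_itv/= lte_fin; case: ltP => /= h; first by rewrite subr0.
    by apply/eqP; rewrite eq_le h t0.
  rewrite (_ : fine _ = t)//.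
  rewrite -g0E// /F (clE t)// (clE 0) ?lexx ?ltW// mulr0; lra.
exists g; split => //.
  by move=> t tT; rewrite gE//; lra.
have igS y : mu.-integrable [set` Interval (BLeft 0) (BRight y)] (EFin \o g).
  by apply: integrableS ig => //; exact: measurable_itv.
have lg : locally_integrable [set: R] g.
  by apply: open_integrable_locally => //; exact: openT.
have := FTC1 igS lg; apply: filterS.
move=> t Ht /andP[t0 tT].
move: Ht => /(_ _)[|d1 d2]; first by rewrite /= lte_fin.
have near_eq : \forall y \near t, \int[mu]_(x in `[0, y]) g x = (C - cst (C 0)) y.
  have tin : t \in `]0, T[ by rewrite in_itv/= t0.
  apply: filterS (near_in_itvoo tin) => y; rewrite in_itv/= => /andP[y0 yT].
  by rewrite gE// !ltW.
have d3 := near_eq_derivable near_eq d1.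
have CE : C = (C - cst (C 0)) + cst (C 0) by rewrite subrK.
have d4 : derivable C t 1 by rewrite CE; apply: derivableD.
split => //.
rewrite -d2 !derive1E (near_eq_derive _ near_eq).
by rewrite deriveB// derive_cst subr0.
Qed.

(** The densities on growing intervals are glued cell by cell. They agree almost everywhere, each
    being the derivative of [C]. *)
Lemma locally_lipschitz_density (C : R -> R) :
  locally_lipschitz C ->
  exists c : R -> R, [/\ measurable_fun setT c,
    forall T, mu.-integrable `[0, T]%classic (EFin \o c),
    forall t, 0 <= t -> C t = C 0 + \int[mu]_(x in `[0, t]) c x &
    {ae mu, forall t : R, 0 < t -> derivable C t 1 /\ derive1 C t = c t}].
Proof.
move=> CL.
have hg : forall n : nat, exists g : R -> R, [/\ mu.-integrable setT (EFin \o g),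
    forall t, 0 <= t <= n.+2%:R -> C t = C 0 + \int[mu]_(x in `[0, t]) g x &
    {ae mu, forall t : R, 0 < t < n.+2%:R -> derivable C t 1 /\ derive1 C t = g t}].
  move=> n; have n0 : 0 < n.+2%:R :> R by rewrite ltr0n.
  by have [M M0 CM] := CL _ n0; exact: lipschitz_density_itv M0 n0 CM.
have [g Hg] := choice hg.
pose P : set (measurableTypeR R) := `[0, +oo[%classic.
have mP : measurable P by exact: measurable_itv.
(* On [[n, n + 1[] the density [g n] is used, whose interval [[0, n + 2]] reaches beyond that
   cell. *)
pose c : R -> R := (fun x => g (Num.truncn x) x) \_ P.
have cE t : 0 <= t -> c t = g (Num.truncn t) t.
  by move=> t0; rewrite /c patchE ifT// inE /P/= in_itv/= t0.
have mg n : measurable_fun (setT : set (measurableTypeR R)) (g n).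
  by have [/integrableP[/measurable_EFinP]] := Hg n.
have mc : measurable_fun (setT : set (measurableTypeR R)) c.
  apply/(measurable_restrictT _ mP).
  pose E (n : nat) : set (measurableTypeR R) := `[n%:R, n.+1%:R[%classic.
  have -> : P = \bigcup_n E n.
    apply/seteqP; split => [x|x [n _]]; rewrite /P /E/= !in_itv/= ?andbT.
      by move=> x0; exists (Num.truncn x) => //=; rewrite in_itv/= truncn_itv.
    by case/andP => nx _; apply: le_trans nx; rewrite ler0n.
  apply/measurable_fun_bigcup => [n|n]; first exact: measurable_itv.
  apply: (@eq_measurable_fun _ _ _ _ _ (g n)).
    move=> x; rewrite inE /E/= in_itv/= => xn.
    by rewrite (truncn_def xn).
  by apply: measurable_funS (mg n).
have ae0 : {ae mu, forall t : R, t != 0}.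
  exists [set 0 : R]; split; [exact: measurable_set1|exact: lebesgue_measure_set1|].
  by move=> t /= /negP; rewrite negbK => /eqP.
have aeg : {ae mu, forall t : R, forall n : nat, 0 < t < n.+2%:R ->
    derivable C t 1 /\ derive1 C t = g n t}.
  by apply/ae_foralln => n; have [] := Hg n.
have tr (t : R) : 0 <= t -> t < (Num.truncn t).+2%:R.
  by move=> /truncn_itv/andP[_ /lt_trans]; apply; rewrite ltr_nat.
have aec : {ae mu, forall t : R, 0 < t -> derivable C t 1 /\ derive1 C t = c t}.
  apply: filterS aeg => t Ht t0; rewrite (cE _ (ltW t0)).
  by apply: Ht; rewrite t0 tr// ltW.
have ceq T n : T < n.+2%:R -> ae_eq mu `[0, T]%classic (EFin \o c) (EFin \o g n).
  move=> Tn; apply: filterS3 ae0 aeg aec => t t0 Ht Hc /=; rewrite in_itv/= => /andP[t0' tT].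
  have tpos : 0 < t by rewrite lt_neqAle eq_sym t0.
  have [_ <-] := Hc tpos.
  by have [|_ ->] := Ht n; first by rewrite tpos (le_lt_trans tT).
have mI T : measurable (`[0, T]%classic : set (measurableTypeR R)) by exact: measurable_itv.
have mec T : measurable_fun (`[0, T]%classic : set (measurableTypeR R)) (EFin \o c).
  by apply/measurable_EFinP; exact: measurable_funS mc.
have meg n T : measurable_fun (`[0, T]%classic : set (measurableTypeR R)) (EFin \o g n).
  by apply/measurable_EFinP; exact: measurable_funS (mg n).
exists c; split => //.
  move=> T; have [T0|T0] := ltP T 0.
    rewrite set_itv_ge; last by rewrite bnd_simp -ltNge.
    exact: integrable_set0.
  apply/integrableP; split; first exact: mec.
  have [ig _ _] := Hg (Num.truncn T).
  have /integrableP[_] : mu.-integrable `[0, T]%classic (EFin \o g (Num.truncn T)).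
    by apply: integrableS ig.
  apply: le_lt_trans; rewrite le_eqVlt; apply/orP; left; apply/eqP.
  apply: ae_eq_integral => //.
  - by apply: measurableT_comp => //; exact: mec.
  - by apply: measurableT_comp => //; exact: meg.
  - by apply: filterS (ceq T _ (tr _ T0)) => t /[apply] ->.
move=> t t0; have [ig CE _] := Hg (Num.truncn t).
rewrite CE ?t0 ?ltW ?tr//; congr (_ + fine _); apply: ae_eq_integral => //.
  exact: meg.
by apply: ae_eq_sym; exact: ceq t _ (tr _ t0).
Qed.

End lipschitz_ftc.

(** * Measurability and integrability of vector-valued functions *)

Section vector_measurability.
Context {R : realType} {H : normedVectType R}.
Local Notation mu := (@lebesgue_measure R).
Local Notation e := (vbasis {:H}).

Let box (a : {ffun 'I_(\dim {:H}) -> rat}) (r : rat) : set H :=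
  [set x | forall j, `|coord e j x - ratr (a j)| < ratr r].

(** Boxes with rational centre and radius are countably many, so coordinatewise measurability will
    control preimages of open sets. *)
Lemma open_boxes (O : set H) : open O ->
  O = \bigcup_(w in [set w | box w.1 w.2 `<=` O]) box w.1 w.2.
Proof.
move=> oO; apply/seteqP; split => [x Ox|x [w /= wO]]; last exact: wO.
have [eps /= eps0 bO] : exists2 eps : R, 0 < eps & ball x eps `<=` O.
  by move: oO; rewrite openE => /(_ _ Ox)/nbhs_ballP[eps eps0 bO]; exists eps.
(* Two points of a box of radius [r] differ by at most [2 r] in each coordinate, so by at most [2 r]
   times the sum of the [|e_j|]; the summand [1] keeps [S] positive. *)
pose S : R := 2 * (1 + \sum_(j < \dim {:H}) `|e`_j|).
have S0 : 0 < S by rewrite mulr_gt0// ltr_pwDl// sumr_ge0.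
have [r] : exists q : rat, ratr q \in `]0, eps / S[%R.
  by apply: rat_in_itvoo; rewrite divr_gt0.
rewrite in_itv/= => /andP[r0 re].
have /choice[a Ha] : forall j : 'I_(\dim {:H}), exists q : rat,
    ratr q \in `]coord e j x - ratr r, coord e j x + ratr r[%R.
  by move=> j; apply: rat_in_itvoo; lra.
have xb : box [ffun j => a j] r x.
  by move=> j; rewrite ffunE; have := Ha j; rewrite in_itv/= ltr_norml; lra.
exists ([ffun j => a j], r) => //= y yb; apply: bO.
rewrite -ball_normE/= (coord_vbasis (memvf (x - y))).
apply: (@le_lt_trans _ _ (\sum_(j < \dim {:H}) 2 * ratr r * `|e`_j|)).
  rewrite (le_trans (ler_norm_sum _ _ _))//; apply: ler_sum => j _.
  rewrite normrZ ler_wpM2r// linearB/=.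
  have := xb j; have := yb j; rewrite !ltr_norml => *.
  by rewrite ler_norml; lra.
rewrite -mulr_sumr; move: re; rewrite ltr_pdivlMr// /S.
set s := \sum_(j < _) _; lra.
Qed.

Lemma vmeasurable_coord (D : set R) (g : R -> H) :
  measurable (D : set (measurableTypeR R)) ->
  (forall j, measurable_fun (D : set (measurableTypeR R)) (fun t => coord e j (g t))) ->
  vmeasurable D g.
Proof.
move=> mD mg; rewrite /vmeasurable; apply: (@measurability _ _ (measurableTypeR R) (g_sigma_algebraType (@open H)) D g (@open H)) => //.
move=> _ [ B oB <-]; rewrite (open_boxes oB).
rewrite preimage_bigcup setI_bigcupr.
have mbox w : measurable ((D : set (measurableTypeR R)) `&` g @^-1` box w.1 w.2).
  have -> : D `&` g @^-1` box w.1 w.2 = D `&` \big[setI/setT]_(j < \dim {:H})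
      (D `&` (fun t => coord e j (g t)) @^-1`
         `]ratr (w.1 j) - ratr w.2, ratr (w.1 j) + ratr w.2[%classic).
    rewrite -bigcap_seq; apply/seteqP; split => t [Dt h]; split => //.
      by move=> j _ /=; split => //=; have := h j; rewrite in_itv/= ltr_norml; lra.
    move=> j; have [|_] := h j; first by rewrite /= mem_index_enum.
    by rewrite /= in_itv/= ltr_norml; lra.
  apply: measurableI => //; apply: big_ind => //; first exact: measurableI.
  by move=> j _; apply: (mg j mD); exact: measurable_itv.
(* The union is reindexed by natural numbers; a code of no box, or of a box outside [B], contributes
   the empty set. *)
rewrite (_ : \bigcup_(i in _) _ = \bigcup_n
    (if unpickle n is Some w then
      if `[< box w.1 w.2 `<=` B >] then D `&` g @^-1` box w.1 w.2 else set0
     else set0)).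
  apply: bigcupT_measurable => n; case: unpickle => [w|//].
  by case: ifPn => // _; exact: mbox.
apply/seteqP; split => t.
  move=> [w /= wO Dw]; exists (pickle w) => //.
  by rewrite pickleK; case: ifPn => //; move/asboolP; exact.
move=> [n _]; case: unpickle => // w; case: ifPn => // /asboolP wO Dw.
by exists w.
Qed.

Lemma vmeasurable_norm (D : set R) (g : R -> H) :
  measurable (D : set (measurableTypeR R)) -> vmeasurable D g ->
  measurable_fun (D : set (measurableTypeR R)) (fun t => `|g t|).
Proof.
move=> mD mg; apply: (measurability _ (RGenOpens.measurableE R)).
move=> _ [_ [a [b ->] <-]].
rewrite [X in measurable X](_ : _ = D `&` g @^-1` ((fun x : H => `|x|) @^-1` `]a, b[%classic))//.
apply: (mg mD); apply: sub_sigma_algebra.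
apply: open_comp; last exact: interval_open.
by move=> x _; exact: norm_continuous.
Qed.

Lemma ae_bounded_Lfun_oo (f : R -> R) (M : R) :
  measurable_fun (setT : set (measurableTypeR R)) f ->
  {ae mu, forall t, `|f t| <= M} -> f \in Lfun mu +oo%E.
Proof.
move=> mf fM; rewrite inE; apply/andP; split; first by rewrite inE.
rewrite inE/= /finite_norm unlock /Lnorm; case: ifP => _ //.
apply: (@le_lt_trans _ _ M%:E); last exact: ltry.
by apply/ess_supP; apply: filterS fM => t /=; rewrite lee_fin.
Qed.

Lemma ae_bounded_Lfun_2 (f : R -> R) (M T : R) :
  measurable_fun (setT : set (measurableTypeR R)) f ->
  {ae mu, forall t, 0 < t < T -> `|f t| <= M} -> (forall t, ~ 0 < t < T -> f t = 0) ->
  f \in Lfun mu 2%:E.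
Proof.
move=> mf fM f0; rewrite inE; apply/andP; split; first by rewrite inE.
rewrite inE/= /finite_norm unlock /Lnorm; apply: poweR_lty.
pose D : set (measurableTypeR R) := `]0, T[%classic.
have mD : measurable D by exact: measurable_itv.
pose f2 : R -> \bar R := (cst (M ^+ 2)%:E) \_ D.
apply: (@le_lt_trans _ _ (\int[mu]_x f2 x)%E); last first.
  have Dfin : (mu `]0%R, T[%classic < +oo)%E.
    by rewrite lebesgue_measure_itv/=; case: ifP => // _; rewrite ltry.
  by rewrite /f2 -integral_mkcond integral_cst// lte_mul_pinfty// lee_fin sqr_ge0.
apply: ae_ge0_le_integral => //.
- by move=> x _; rewrite lee_fin powR_ge0.
- apply/measurable_EFinP.
  apply: (@measurableT_comp _ _ _ _ _ _ (@powR R ^~ 2)) => //.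
  exact: measurableT_comp.
- by move=> x _; rewrite /f2 patchE; case: ifP => // _; rewrite lee_fin sqr_ge0.
- exact/(measurable_restrictT (cst (M ^+ 2)%:E) mD)/measurable_cst.
apply: filterS fM => t Ht _; rewrite /f2 patchE; case: ifPn => tD.
  have {}Ht : `|f t| <= M by apply: Ht; move: tD; rewrite inE /D/= in_itv.
  have M0 : 0 <= M := le_trans (normr_ge0 _) Ht.
  rewrite lee_fin powR_mulrn//; exact: lerXn2r.
have ft : f t = 0.
  by apply: f0 => t0T; move/negP: tD; apply; rewrite inE /D/= in_itv.
by rewrite /= ft normr0 powR0// pnatr_eq0.
Qed.

End vector_measurability.

(** * Difference quotients and densities of vector-valued curves *)

Definition dquot_cvg (R : realType) (V : normedModType R) (f : R -> V) (t : R) (l : V) :=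
  (fun h => h^-1 *: (f (h + t) - f t)) @ 0^' --> l.

Lemma dquot_cvgP (R : realType) (V : normedModType R) (f : R -> V) (t : R) (l : V) :
  dquot_cvg f t l <-> derivable f t 1 /\ derive1 f t = l.
Proof.
have E : (fun h : R => h^-1 *: (f (h *: 1 + t) - f t)) =
         (fun h : R => h^-1 *: (f (h + t) - f t)).
  by apply/funext => h; rewrite [h *: 1]mulr1.
rewrite /dquot_cvg /derivable E; split.
  move=> fl; split; first by apply/cvg_ex; exists l.
  exact: (cvg_lim (@norm_hausdorff _ V) fl).
by move=> [/cvg_ex[l' fl'] <-]; rewrite /derive1 (cvg_lim (@norm_hausdorff _ V) fl').
Qed.

(** As the two-sided limit exists, increments [s = 1 / (k + 1)] suffice, and the quadratic error
    vanishes after division by [s]. Through this lemma the integrated inequalities reach the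
    derivatives. *)
Lemma dquot_cvg_le (R : realType) (F : R -> R) (t l a b : R) :
  dquot_cvg F t l ->
  (forall s, 0 < s <= 1 -> F (s + t) - F t <= a * s + b * s ^+ 2) -> l <= a.
Proof.
move=> Fl Fle.
have hn : (harmonic : nat -> R) k @[k --> \oo] --> (0 : R)^'.
  move=> A hA; have hn : \forall k \near \oo, harmonic k != 0 :> R -> A (harmonic k).
    exact: (@cvg_harmonic R _ hA).
  suff : \forall k \near \oo, A (harmonic k) by [].
  by apply: filterS hn => k; apply; rewrite gt_eqF// harmonic_gt0.
have h1 : (harmonic k)^-1 *: (F (harmonic k + t) - F t) @[k --> \oo] --> l.
  exact: (cvg_comp (harmonic : nat -> R) (fun h => h^-1 *: (F (h + t) - F t)) hn Fl).
have h2 : a + b * harmonic k @[k --> \oo] --> a.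
  rewrite -[X in _ --> X]addr0; apply: cvgD; first exact: cvg_cst.
  by rewrite -(mulr0 b); apply: cvgM; [exact: cvg_cst|exact: cvg_harmonic].
apply: (ler_cvg_to h1 h2); apply: nearW => k.
have k0 := @harmonic_gt0 R k.
have k1 : harmonic k <= 1 :> R by rewrite /harmonic/= invf_le1// ler1n.
rewrite -[_ *: _]/(_ * _) mulrC ler_pdivrMr// mulrDl -mulrA -expr2.
by apply: Fle; rewrite k0.
Qed.

Section vector_density.
Context {R : realType} {H : normedVectType R}.
Local Notation mu := (@lebesgue_measure R).
Local Notation e := (vbasis {:H}).

Lemma vector_locally_lipschitz_density (U : R -> H) :
  locally_lipschitz U ->
  exists g : R -> H, [/\ forall j, measurable_fun setT (fun t => coord e j (g t)),
    forall T, vintegrable `[0, T]%classic g,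
    forall t, 0 <= t -> U t = U 0 + vintegral `[0, t]%classic g &
    {ae mu, forall t : R, 0 < t -> dquot_cvg U t (g t)}].
Proof.
move=> UL; have [K K0 HK] := @coord_bound R H.
have hc : forall j : 'I_(\dim {:H}), exists c : R -> R, [/\ measurable_fun setT c,
    forall T, mu.-integrable `[0, T]%classic (EFin \o c),
    forall t, 0 <= t -> coord e j (U t) = coord e j (U 0) + \int[mu]_(x in `[0, t]) c x &
    {ae mu, forall t : R, 0 < t -> derivable (fun t => coord e j (U t)) t 1 /\
       derive1 (fun t => coord e j (U t)) t = c t}].
  move=> j; apply: (@locally_lipschitz_density R (fun t => coord e j (U t))) => T T0.
  have [M M0 HM] := UL T T0; exists (K * M); first by rewrite mulr_ge0// ltW.
  move=> s t s0 st tT; rewrite -linearB/= (le_trans (HK _ _))// -mulrA.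
  by rewrite ler_pM2l// HM.
have [c Hc] := choice hc.
pose g t : H := \sum_(j < \dim {:H}) c j t *: e`_j.
have cg j t : coord e j (g t) = c j t.
  by rewrite /g coord_sum_free// (basis_free (vbasisP _)).
have mg D : measurable (D : set (measurableTypeR R)) -> vmeasurable D g.
  move=> mD; apply: vmeasurable_coord => // j.
  rewrite (_ : (fun t => _) = c j); last by apply/funext => t; rewrite cg.
  by have [mc _ _ _] := Hc j; apply: measurable_funS mc.
exists g; split.
- move=> j; rewrite (_ : (fun t => _) = c j); last by apply/funext => t; rewrite cg.
  by have [] := Hc j.
- move=> T; have mI : measurable (`[0, T]%classic : set (measurableTypeR R)).
    exact: measurable_itv.
  split; first exact: mg.
  apply: (@le_integrable _ _ _ mu _ mI _
    (fun t => \sum_(j < \dim {:H}) ((`|e`_j|)%:E * (`|c j t|)%:E))%E).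
  - by apply/measurable_EFinP; apply: vmeasurable_norm => //; exact: mg.
  - move=> t _; rewrite sumEFin !abse_EFin lee_fin normr_id.
    rewrite [leRHS]ger0_norm ?sumr_ge0// /g (le_trans (ler_norm_sum _ _ _))//.
    by apply: ler_sum => j _; rewrite normrZ mulrC.
  - apply: integrable_sum => // j _; apply: integrableZl => //.
    by have [_ ic _ _] := Hc j; exact: integrable_norm (ic T).
- move=> t t0; rewrite /vintegral -[LHS](subrK (U 0)) addrC; congr (_ + _).
  rewrite (coord_vbasis (memvf (U t - U 0))); apply: eq_bigr => j _.
  congr (_ *: _); have [_ _ /(_ t t0) e1 _] := Hc j.
  rewrite linearB/= e1 addrC addKr.
  by apply: eq_Rintegral => x _; rewrite cg.
have : {ae mu, forall t : R, forall j, 0 < t -> derivable (fun t => coord e j (U t)) t 1 /\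
       derive1 (fun t => coord e j (U t)) t = c j t}.
  by apply: filter_forall => j; have [] := Hc j.
apply: filterS => t Ht t0; rewrite /dquot_cvg.
have -> : (fun h => h^-1 *: (U (h + t) - U t)) = (fun h => \sum_(j < \dim {:H})
    (h^-1 *: (coord e j (U (h + t)) - coord e j (U t))) *: e`_j).
  apply/funext => h; rewrite {1}(coord_vbasis (memvf (U (h + t) - U t))) scaler_sumr.
  by apply: eq_bigr => j _; rewrite scalerA linearB.
apply: cvg_sum => j _; apply: cvgZr_tmp.
by have /dquot_cvgP := Ht j t0.
Qed.

End vector_density.

(** * Time integrals of discrete sequences *)

Section partial_sums.
Context {R : realType}.
Implicit Types (n k : nat) (s t : R).

Definition step_size n : R := n.+1%:R^-1.
Definition step_index n t : nat := Num.truncn (t * n.+1%:R).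
(** The integral of the piecewise constant interpolation of [c n], with [t] rounded down to the grid
    of mesh [1 / (n + 1)]. *)
Definition psum (V : lmodType R) (c : nat -> nat -> V) n t : V :=
  step_size n *: \sum_(0 <= k < step_index n t) c n k.

Lemma step_size_gt0 n : 0 < step_size n.
Proof. by rewrite invr_gt0 ltr0Sn. Qed.

Lemma step_size_le1 n : step_size n <= 1.
Proof. by rewrite invf_le1 ?ltr0Sn// ler1n. Qed.

Lemma step_index0 n : step_index n 0 = 0%N.
Proof. by rewrite /step_index mul0r truncn0. Qed.

Lemma step_index_le n s t : s <= t -> (step_index n s <= step_index n t)%N.
Proof. by move=> st; apply: le_truncn; rewrite ler_pM2r// ltr0Sn. Qed.

Lemma step_index_itv n t : 0 <= t ->
  (step_index n t)%:R * step_size n <= t < (step_index n t).+1%:R * step_size n.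
Proof.
move=> t0; rewrite ler_pdivrMr ?ltr0Sn// ltr_pdivlMr ?ltr0Sn//.
by apply: truncn_itv; rewrite mulr_ge0.
Qed.

Lemma lt_step_index n t k : 0 <= t -> (k < step_index n t)%N ->
  k.+1%:R * step_size n <= t.
Proof.
move=> t0 kt; have /andP[+ _] := step_index_itv n t0; apply: le_trans.
by rewrite ler_pM2r ?step_size_gt0// ler_nat.
Qed.

Lemma step_count n s t : 0 <= s -> s <= t ->
  (step_index n t - step_index n s)%:R * step_size n <= t - s + step_size n.
Proof.
move=> s0 st; rewrite natrB ?step_index_le// mulrBl.
have /andP[h1 _] := step_index_itv n (le_trans s0 st).
have /andP[_] := step_index_itv n s0; rewrite -natr1 mulrDl mul1r; lra.
Qed.

Lemma psum0 (V : lmodType R) (c : nat -> nat -> V) n : psum c n 0 = 0.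
Proof. by rewrite /psum step_index0 big_nil scaler0. Qed.

Lemma psumB (V : lmodType R) (c : nat -> nat -> V) n s t : s <= t ->
  psum c n t - psum c n s =
  step_size n *: \sum_(step_index n s <= k < step_index n t) c n k.
Proof.
move=> st; rewrite /psum -scalerBr.
by rewrite (@big_cat_nat _ _ _ (step_index n s)) ?step_index_le//= addrAC subrr add0r.
Qed.

(** Lipschitz up to one step: rounding both ends to the grid can add one summand, an error that
    disappears in the limit. *)
Lemma psum_lip (V : normedModType R) (c : nat -> nat -> V) n (M T s t : R) :
  (forall k, k.+1%:R * step_size n <= T -> `|c n k| <= M) -> 0 <= M ->
  0 <= s -> s <= t -> t <= T ->
  `|psum c n t - psum c n s| <= M * (t - s + step_size n).
Proof.
move=> cM M0 s0 st tT; rewrite psumB// normrZ gtr0_norm ?step_size_gt0//.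
have h1 : `|\sum_(step_index n s <= k < step_index n t) c n k| <=
    M * (step_index n t - step_index n s)%:R.
  rewrite (le_trans (ler_norm_sum _ _ _))// mulr_natr -sumr_const_nat !big_nat.
  apply: ler_sum => k /andP[_ kt].
  by apply: cM; apply: le_trans (lt_step_index (le_trans s0 st) kt) tT.
rewrite mulrC; apply: le_trans (ler_wpM2r (ltW (step_size_gt0 n)) h1) _.
by rewrite -mulrA ler_wpM2l// step_count.
Qed.

Definition locally_bounded (V : normedModType R) (c : nat -> nat -> V) :=
  forall T, 0 < T -> exists2 M : R, 0 <= M &
    forall n k, k.+1%:R * step_size n <= T -> `|c n k| <= M.

Section limit.
Variables (U : set_system nat) (UU : UltraFilter U) (ooU : \oo `<=` U).

Lemma step_size_cvg : step_size n @[n --> U] --> (0 : R).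
Proof. by apply: cvg_trans (@cvg_harmonic R); exact: cvg_app. Qed.

(** Compactness enters only through the first hypothesis, so real and [H]-valued sums are treated
    together. *)
Lemma psum_limit (V : normedModType R) (c : nat -> nat -> V) :
  (forall (x : nat -> V) (M : R), (forall n, `|x n| <= M) -> cvg (x @ U)) ->
  locally_bounded c ->
  exists I : R -> V, [/\ forall t, 0 <= t -> psum c n t @[n --> U] --> I t, I 0 = 0 &
    locally_lipschitz I].
Proof.
move=> cvgU cb.
have /choice[I HI] : forall t, exists l : V, 0 <= t -> psum c n t @[n --> U] --> l.
  move=> t; have [t0|t0] := leP 0 t; last by exists 0.
  have [M M0 cM] := cb (t + 1) (ltr_wpDl t0 ltr01).
  have /cvg_ex[l hl] : cvg (psum c n t @[n --> U]).
    apply: (cvgU _ (M * (t + 1))) => n.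
    rewrite -[psum c n t]subr0 -(psum0 c n).
    apply: le_trans (psum_lip (cM n) M0 (lexx 0) t0 _) _; first by rewrite lerDl.
    by rewrite subr0 ler_wpM2l// lerD2l step_size_le1.
  by exists l.
exists I; split => //.
  have h0 : psum c n 0 @[n --> U] --> I 0 by exact: HI.
  apply: (cvg_unique (@norm_hausdorff _ V) h0).
  rewrite (_ : (fun n => psum c n 0) = fun=> 0); first exact: cvg_cst.
  by apply/funext => n; exact: psum0.
move=> T T0; have [M M0 cM] := cb T T0; exists M => // s t s0 st tT.
have h1 : `|psum c n t - psum c n s| @[n --> U] --> `|I t - I s|.
  by apply: cvg_norm; apply: cvgB; apply: HI => //; exact: le_trans st.
have h2 : M * (t - s + step_size n) @[n --> U] --> M * (t - s).
  apply: cvgM; first exact: cvg_cst.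
  rewrite -[X in _ --> X]addr0; apply: cvgD; first exact: cvg_cst.
  exact: step_size_cvg.
apply: (ler_cvg_to h1 h2); apply: nearW => n.
exact: psum_lip (cM n) M0 s0 st tT.
Qed.

(** Over the window from [t] to [s + t] the iterates stay within [M s] of [w], up to a vanishing
    error. Each summand is then at most [A M s], and the window has length [s]. *)
Lemma psum_quadratic (H : normedModType R) (x : nat -> nat -> H) (w : H)
    (c : nat -> nat -> R) (A M T s t a b : R) :
  0 <= A -> 0 <= M -> 0 <= t -> 0 <= s -> s + t <= T ->
  (forall n k, k.+1%:R * step_size n <= T ->
     `|x n k.+1 - x n k| <= M * step_size n) ->
  (forall n k, k.+1%:R * step_size n <= T -> c n k <= A * `|x n k.+1 - w|) ->
  x n (step_index n t) @[n --> U] --> w ->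
  psum c n t @[n --> U] --> a -> psum c n (s + t) @[n --> U] --> b ->
  b - a <= A * M * s ^+ 2.
Proof.
move=> A0 M0 t0 s0 stT xM cA xw ca cb.
have tst : t <= s + t by rewrite lerDr.
have st0 : 0 <= s + t by rewrite addr_ge0.
have h1 : psum c n (s + t) - psum c n t @[n --> U] --> b - a by exact: cvgB.
pose d n := `|x n (step_index n t) - w|.
have h2 : (s + step_size n) * (A * (M * (s + step_size n) + d n)) @[n --> U]
    --> A * M * s ^+ 2.
  have -> : A * M * s ^+ 2 = (s + 0) * (A * (M * (s + 0) + `|w - w|)).
    by rewrite subrr normr0 !addr0; ring.
  have hs : s + step_size n @[n --> U] --> s + 0.
    by apply: cvgD; [exact: cvg_cst|exact: step_size_cvg].
  apply: cvgM => //; apply: cvgM; first exact: cvg_cst.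
  apply: cvgD; first by apply: cvgM => //; exact: cvg_cst.
  by apply: cvg_norm; apply: cvgB => //; exact: cvg_cst.
apply: (ler_cvg_to h1 h2); apply: nearW => n.
have cnt : (step_index n (s + t) - step_index n t)%:R * step_size n <= s + step_size n.
  by have := step_count n t0 tst; rewrite addrK.
have xk k : (step_index n t <= k)%N -> (k <= step_index n (s + t))%N ->
    `|x n k - x n (step_index n t)| <= M * ((k - step_index n t)%:R * step_size n).
  move=> /subnK <-; set m := (k - _)%N; rewrite addnK; elim: m => [|m IH] mt.
    by rewrite add0n subrr normr0 mul0r mulr0.
  have mt' : (m + step_index n t < step_index n (s + t))%N by rewrite -addSn.
  have := xM n _ (le_trans (lt_step_index st0 mt') stT).
  have {}IH := IH (ltnW mt'); rewrite addSn => h.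
  have -> : x n (m + step_index n t).+1 - x n (step_index n t) =
    (x n (m + step_index n t).+1 - x n (m + step_index n t)) +
    (x n (m + step_index n t) - x n (step_index n t)) by rewrite addrA subrK.
  apply: le_trans (ler_normD _ _) _; rewrite -natr1; lra.
have d0 : 0 <= d n by rewrite /d.
have sh0 : 0 <= s + step_size n by rewrite addr_ge0// ltW// step_size_gt0.
have ck k : (step_index n t <= k)%N && (k < step_index n (s + t))%N ->
    c n k <= A * (M * (s + step_size n) + d n).
  move=> /andP[tk kt]; apply: le_trans (cA n k _) _.
    exact: le_trans (lt_step_index st0 kt) stT.
  rewrite ler_wpM2l//.
  have -> : x n k.+1 - w = (x n k.+1 - x n (step_index n t)) +
    (x n (step_index n t) - w) by rewrite addrA subrK.
  apply: le_trans (ler_normD _ _) _; rewrite lerD2r.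
  apply: le_trans (xk _ (leqW tk) kt) _; rewrite ler_wpM2l//.
  apply: le_trans cnt; rewrite ler_pM2r ?step_size_gt0// ler_nat.
  exact: leq_sub2r.
rewrite psumB// -[_ *: _]/(_ * _).
set B := A * (M * (s + step_size n) + d n) in ck *.
have B0 : 0 <= B by rewrite mulr_ge0// addr_ge0// mulr_ge0.
have h3 : \sum_(step_index n t <= k < step_index n (s + t)) c n k <=
    B * (step_index n (s + t) - step_index n t)%:R.
  rewrite mulr_natr -sumr_const_nat !big_nat; apply: ler_sum => k kt.
  exact: ck.
apply: le_trans (ler_wpM2l (ltW (step_size_gt0 n)) h3) _.
by rewrite mulrCA mulrC ler_wpM2r// mulrC.
Qed.

End limit.
End partial_sums.
Arguments step_size {R} n.

(** * The implicit scheme and its a priori bounds *)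

Section scheme.
Context {R : realType} {H : normedVectType R}.
Variable form : {dot H for idfun}.
Hypothesis hform : hilbert_norm form.
Variable (K : set H).
Hypotheses (Kclosed : closed K) (Kconvex : convex_set K).
Variables (q : nat) (f : 'I_q -> H -> R).
Hypotheses (q_gt0 : (0 < q)%N)
  (fconvex : forall i, convex_function [set: H] (f i))
  (fcont : forall i, continuous (f i))
  (flip : forall i (B : set H), bounded_set B -> [lipschitz f i x | x in B])
  (fbound : forall i, has_lbound (range (f i))).
Variables (u0 : H) (Ku0 : K u0).
Local Notation h := (@step_size R).

Definition is_scheme (x eta : nat -> nat -> H) (theta : nat -> nat -> 'I_q -> R)
    (p : nat -> nat -> 'I_q -> H) := forall n, x n 0%N = u0 /\ forall k,
  [/\ K (x n k), unit_simplex (theta n k),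
      normal_cone form K (x n k.+1) (eta n k),
      forall i, subdiff form (f i) (x n k.+1) (p n k i) &
      x n k.+1 = x n k - h n *: (eta n k + \sum_i theta n k i *: p n k i) /\
      forall i, f i (x n k.+1) - f i (x n k) +
        (h n)^-1 * `|x n k.+1 - x n k| ^+ 2 <= 0].

Lemma scheme_exists : exists x eta theta p, is_scheme x eta theta p.
Proof.
have /choice[S HS] : forall nx : nat * H,
    exists w : H * H * ('I_q -> R) * ('I_q -> H), K nx.2 ->
    [/\ K w.1.1.1, unit_simplex w.1.2, normal_cone form K w.1.1.1 w.1.1.2,
      forall i, subdiff form (f i) w.1.1.1 (w.2 i) &
      w.1.1.1 = nx.2 - h nx.1 *: (w.1.1.2 + \sum_i w.1.2 i *: w.2 i) /\
      forall i, f i w.1.1.1 - f i nx.2 +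
        (h nx.1)^-1 * `|w.1.1.1 - nx.2| ^+ 2 <= 0].
  (* Outside [K] the step is an arbitrary value, never reached because the iterates remain in
     [K]. *)
  move=> [n x]; have [Kx|nKx] := pselect (K x); last by exists (0, 0, (fun=> 0), (fun=> 0)).
  have [x' [eta [theta [p [h1 h2 h3 h4 h5]]]]] := implicit_step hform Kclosed Kconvex
    q_gt0 fconvex fcont flip fbound Kx (@step_size_gt0 R n).
  by exists (x', eta, theta, p) => /= _; split => //; case: h2.
pose x n k := iter k (fun y => (S (n, y)).1.1.1) u0.
have Kx n k : K (x n k).
  by elim: k => [//|k IH]; rewrite /x iterS -/(x n k); have [] := HS (n, x n k) IH.
exists x, (fun n k => (S (n, x n k)).1.1.2), (fun n k => (S (n, x n k)).1.2),
  (fun n k => (S (n, x n k)).2) => n; split => // k.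
by have [h1 h2 h3 h4 h5] := HS (n, x n k) (Kx n k); split.
Qed.

Variables (x eta : nat -> nat -> H) (theta : nat -> nat -> 'I_q -> R)
  (p : nat -> nat -> 'I_q -> H).
Hypothesis sch : is_scheme x eta theta p.

(* Linearising [- |y|^2 / h <= - 2 <d, y> + h |d|^2] makes the energy estimate telescope. *)
Lemma scheme_energy n k m i d : f i (x n (k + m)%N) - f i (x n k) <=
  - 2 * form d (x n (k + m)%N - x n k) + m%:R * h n * `|d| ^+ 2.
Proof.
elim: m => [|m IH]; first by rewrite addn0 !subrr dot0r !mul0r mulr0 addr0.
have h0 := @step_size_gt0 R n.
have [_ /(_ (k + m)%N)[_ _ _ _ [_ /(_ i)]]] := sch n.
rewrite addnS; set y := x n (k + m)%N in IH *; set z := x n (k + m).+1 => e.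
have -> : z - x n k = (z - y) + (y - x n k) by rewrite addrA subrK.
rewrite dotDr -[m.+1%:R]natr1 !mulrDl mul1r.
have : 0 <= (h n)^-1 * `|(z - y) + (- h n) *: d| ^+ 2.
  by rewrite mulr_ge0 ?sqr_ge0// invr_ge0 ltW.
rewrite (normD2 hform (z - y)) dotZr normrZ normrN (gtr0_norm h0) (dotC form (z - y) d).
have -> : (h n)^-1 * (`|z - y| ^+ 2 + 2 * (- h n * form d (z - y)) +
  (h n * `|d|) ^+ 2) = (h n)^-1 * `|z - y| ^+ 2 - 2 * form d (z - y) + h n * `|d| ^+ 2.
  by field; rewrite gt_eqF.
lra.
Qed.

(** The energy estimate confines the iterates to a ball independent of [n]; local Lipschitz
    continuity of the [f i] on a slightly larger ball bounds the rest. *)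
Lemma scheme_bounds T : 0 < T -> exists r M : R, [/\ 0 <= M,
  forall n k, k%:R * h n <= T -> `|x n k| <= r,
  forall n k, k.+1%:R * h n <= T -> [/\ `|x n k.+1 - x n k| <= M * h n,
     `|eta n k| <= M & forall i, `|p n k i| <= M],
  forall i y z, `|y| <= r -> `|z| <= r -> `|f i y - f i z| <= M * `|y - z| &
  forall i y v, `|y| <= r -> subdiff form (f i) y v -> `|v| <= M].
Proof.
move=> T0; have i0 : 'I_q by exact: (Ordinal q_gt0).
pose D := f i0 u0 - inf (range (f i0)).
pose r := `|u0| + (D / T^-1 + 1).
have xr n k : k%:R * h n <= T -> `|x n k| <= r.
  move=> kT; have -> : x n k = u0 + (x n k - u0) by rewrite addrC subrK.
  apply: le_trans (ler_normD _ _) _; rewrite lerD2l.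
  apply: norm_le_of_sqr; first by rewrite invr_gt0.
  set y := x n k - u0.
  have [x0 _] := sch n.
  (* With [d = y / T] and [k h <= T] the right-hand side is at most [- |y|^2 / T], so
     [|y|^2 / T <= D]. *)
  have := scheme_energy n 0 k i0 (T^-1 *: y); rewrite add0n x0 -/y.
  rewrite dotZl -hform normrZ gtr0_norm ?invr_gt0// exprMn.
  have : inf (range (f i0)) <= f i0 (x n k) by apply: ge_inf => //; exists (x n k).
  have y0 : 0 <= `|y| ^+ 2 by rewrite sqr_ge0.
  have : k%:R * h n * (T^-1 ^+ 2 * `|y| ^+ 2) <= T^-1 * `|y| ^+ 2.
    rewrite [leRHS](_ : _ = T * (T^-1 ^+ 2 * `|y| ^+ 2)); last first.
      by field; rewrite gt_eqF.
    by rewrite ler_wpM2r// mulr_ge0// sqr_ge0.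
  rewrite /D; set a := T^-1 * `|y| ^+ 2; set b := _ * _ * (_ * _); lra.
have /choice[L HL] : forall i, exists L : R, 0 <= L /\ forall y z,
    `|y| <= r + 1 -> `|z| <= r + 1 -> `|f i y - f i z| <= L * `|y - z|.
  by move=> i; have [L L0 HL] := lipschitz_ball (@flip i) (r + 1); exists L.
pose M := L i0 + \sum_i L i.
have Ls i : L i <= \sum_i L i.
  rewrite (bigD1 i)//= lerDl; apply: sumr_ge0 => j _.
  by have [] := HL j.
have Ls0 : 0 <= \sum_i L i.
  by apply: sumr_ge0 => j _; have [] := HL j.
have L0 : 0 <= L i0 by have [] := HL i0.
have LM i : L i <= M by rewrite /M ler_wpDl.
have rr (y : H) : `|y| <= r -> `|y| <= r + 1.
  by move/le_trans; apply; rewrite lerDl.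
have sdL i y v : `|y| <= r -> subdiff form (f i) y v -> `|v| <= L i.
  by have [Li HLi] := HL i => *; apply: (subdiff_norm_le hform HLi) => //; eassumption.
exists r, M; split => //; first by rewrite /M addr_ge0.
- move=> n k kT; have [_ /(_ k)[_ [th01 th1] _ sp [xE en]]] := sch n.
  have h0 := @step_size_gt0 R n.
  have xk1 := xr n _ kT.
  have xk : `|x n k| <= r.
    by apply: xr; apply: le_trans kT; rewrite ler_pM2r// ler_nat.
  (* The one-step energy decay [d^2 / h] is at most the variation [L d] of [f i0]. *)
  have spd : `|x n k.+1 - x n k| <= L i0 * h n.
    have [_ /(_ _ _ (rr _ xk) (rr _ xk1))] := HL i0.
    rewrite distrC; have := en i0; set d := `|_ - _|.
    move=> e1 /ler_normlP[_ e2].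
    have [->|d0] := eqVneq d 0; first by rewrite mulr_ge0// ltW.
    have dpos : 0 < d by rewrite lt_neqAle eq_sym d0 normr_ge0.
    have : (h n)^-1 * d ^+ 2 <= L i0 * d by lra.
    by rewrite expr2 mulrA ler_pM2r// mulrC ler_pdivrMr.
  have pL i : `|p n k i| <= L i by apply: sdL (sp i).
  split; last by move=> i; exact: le_trans (pL i) (LM i).
    by apply: le_trans spd _; rewrite ler_pM2r.
  (* The normal component is recovered from the scheme; this explains the two summands of [M]. *)
  have -> : eta n k = - ((h n)^-1 *: (x n k.+1 - x n k)) - \sum_i theta n k i *: p n k i.
    by rewrite xE addrAC subrr add0r scalerN scalerA mulVf ?gt_eqF// scale1r opprK addrK.
  apply: le_trans (ler_normB _ _) _; rewrite /M lerD//.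
    by rewrite normrN normrZ gtr0_norm ?invr_gt0// mulrC ler_pdivrMr.
  apply: le_trans (ler_norm_sum _ _ _) _; apply: ler_sum => i _.
  have /andP[t0 t1] := th01 i.
  by rewrite normrZ ger0_norm// -[leRHS]mul1r ler_pM.
- move=> i y z yr zr; have [_ /(_ _ _ (rr _ yr) (rr _ zr))] := HL i.
  by move/le_trans; apply; rewrite ler_wpM2r.
- by move=> i y v yr /(sdL _ _ _ yr)/le_trans; apply.
Qed.

Lemma scheme_psum n t : x n (step_index n t) =
  u0 - psum eta n t - \sum_i psum (fun n k => theta n k i *: p n k i) n t.
Proof.
rewrite /psum -scaler_sumr exchange_big/= -addrA -opprD -scalerDr -big_split/=.
elim: (step_index n t) => [|m IH].
  by rewrite big_nil scaler0 subr0; have [] := sch n.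
rewrite big_nat_recr//= scalerDr opprD addrA -IH.
by have [_ /(_ m)[_ _ _ _ [-> _]]] := sch n.
Qed.

End scheme.

(** * Passage to the limit in the time step *)

Lemma psum_dot (R : realType) (H : normedVectType R) (form : {dot H for idfun})
    (c : nat -> nat -> H) (z : H) n (t : R) :
  psum (fun n k => form (c n k) z) n t = form (psum c n t) z.
Proof. by rewrite /psum dotZl dot_suml. Qed.

Lemma psumMD (R : realType) (c d : nat -> nat -> R) (a : R) n (t : R) :
  psum (fun n k => a * c n k + d n k) n t = a * psum c n t + psum d n t.
Proof.
rewrite /psum big_split/= scalerDr -mulr_sumr; congr (_ + _).
by rewrite -![_ *: _]/(_ * _) mulrCA.
Qed.

Lemma psum1_cvg (R : realType) (U : set_system nat) (UU : UltraFilter U)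
    (ooU : \oo `<=` U) (t : R) : 0 <= t ->
  psum (fun _ _ => 1 : R) n t @[n --> U] --> t.
Proof.
move=> t0; have E n : psum (fun _ _ => 1 : R) n t = (step_index n t)%:R * step_size n.
  by rewrite /psum sumr_const_nat subn0 -[_ *: _]/(_ * _) mulrC.
apply/cvgrPdist_le => eps e0.
have : \forall n \near U, `|0 - step_size n| <= eps :> R.
  by move: eps e0; apply/cvgrPdist_le; exact: step_size_cvg.
apply: filterS => n; rewrite sub0r normrN gtr0_norm ?step_size_gt0// => hn.
apply: le_trans hn; rewrite E; have := step_index_itv n t0.
rewrite -natr1 mulrDl mul1r => /andP[h1 h2]; rewrite ger0_norm ?subr_ge0//; lra.
Qed.

Section limit_curves.
Context {R : realType} {H : normedVectType R}.
Variable form : {dot H for idfun}.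
Hypothesis hform : hilbert_norm form.
Variable (K : set H).
Hypotheses (Kclosed : closed K) (Kconvex : convex_set K).
Variables (q : nat) (f : 'I_q -> H -> R).
Hypotheses (q_gt0 : (0 < q)%N)
  (fconvex : forall i, convex_function [set: H] (f i))
  (fcont : forall i, continuous (f i))
  (flip : forall i (B : set H), bounded_set B -> [lipschitz f i x | x in B])
  (fbound : forall i, has_lbound (range (f i))).
Variables (u0 : H) (Ku0 : K u0).

(** [E], [Th i], [W i], [P i] are limits of the time integrals of [eta], [theta i], [theta i p i],
    [p i]. The products keep their own curve [W i], as limits of averages do not multiply. The
    inclusions survive as inequalities on increments with error [b s^2]. *)
Lemma limit_curves : exists (u E : R -> H) (Th : 'I_q -> R -> R) (W P : 'I_q -> R -> H),
  [/\ u 0 = u0 /\ (forall t, u t = u0 - E t - \sum_i W i t),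
      locally_lipschitz E /\ (forall i, locally_lipschitz (Th i)),
      (forall i, locally_lipschitz (W i)) /\ (forall i, locally_lipschitz (P i)),
      forall t, 0 <= t -> K (u t) /\ \sum_i Th i t = t &
   forall t, 0 <= t -> exists b, forall i s, 0 < s <= 1 ->
     [/\ forall v, K v -> form (E (s + t) - E t) (v - u t) <= b * s ^+ 2,
         0 <= Th i (s + t) - Th i t,
         forall y, (f i (u t) - f i y) * s + form (P i (s + t) - P i t) (y - u t)
           <= b * s ^+ 2,
         forall y, (f i (u t) - f i y) * (Th i (s + t) - Th i t) +
           form (W i (s + t) - W i t) (y - u t) <= b * s ^+ 2 &
         forall d, f i (u (s + t)) - f i (u t) <=
           - 2 * form d (u (s + t) - u t) + s * `|d| ^+ 2]].
Proof.
have [x [eta [theta [p sch]]]] := scheme_exists hform Kclosed Kconvex q_gt0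
  fconvex fcont flip fbound Ku0.
have [U [UU ooU]] := ultraFilterLemma (@eventually_filter).
have bnd T (T0 : 0 < T) := scheme_bounds hform q_gt0 flip fbound sch T0.
pose w i n k := theta n k i *: p n k i.
have th01 n k i : 0 <= theta n k i <= 1.
  by have [_ /(_ k)[_ [+ _] _ _ _]] := sch n; exact.
have cvgH (y : nat -> H) M : (forall n, `|y n| <= M) -> cvg (y @ U).
  exact: ultra_bounded_cvg.
have cvgR (y : nat -> R) M : (forall n, `|y n| <= M) -> cvg (y @ U).
  exact: ultra_bounded_cvgR.
have [|E [Ec E0 El]] := psum_limit UU ooU cvgH (c := eta).
  move=> T T0; have [r [M [M0 _ B _ _]]] := bnd T T0; exists M => // n k kT.
  by have [] := B n k kT.
have hTh : forall i, exists I : R -> R, [/\ forall t, 0 <= t ->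
    psum (fun n k => theta n k i) n t @[n --> U] --> I t, I 0 = 0 & locally_lipschitz I].
  move=> i; apply: (psum_limit UU ooU cvgR) => T T0; exists 1 => // n k _.
  by have /andP[? ?] := th01 n k i; rewrite ger0_norm.
have [Th HTh] := choice hTh.
have hW : forall i, exists I : R -> H, [/\ forall t, 0 <= t ->
    psum (w i) n t @[n --> U] --> I t, I 0 = 0 & locally_lipschitz I].
  move=> i; apply: (psum_limit UU ooU cvgH) => T T0.
  have [r [M [M0 _ B _ _]]] := bnd T T0; exists M => // n k kT.
  have [_ _ /(_ i) pM] := B n k kT; have /andP[? ?] := th01 n k i.
  by rewrite /w normrZ ger0_norm// -[leRHS]mul1r ler_pM.
have [W HW] := choice hW.
have hP : forall i, exists I : R -> H, [/\ forall t, 0 <= t ->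
    psum (fun n k => p n k i) n t @[n --> U] --> I t, I 0 = 0 & locally_lipschitz I].
  move=> i; apply: (psum_limit UU ooU cvgH) => T T0.
  have [r [M [M0 _ B _ _]]] := bnd T T0; exists M => // n k kT.
  by have [_ _ /(_ i)] := B n k kT.
have [P HP] := choice hP.
pose u t := u0 - E t - \sum_i W i t.
have xu t : 0 <= t -> x n (step_index n t) @[n --> U] --> u t.
  move=> t0; rewrite (_ : (fun n => _) = fun n => u0 - psum eta n t - \sum_i psum (w i) n t).
    apply: cvgB; first by apply: cvgB; [exact: cvg_cst|exact: Ec].
    by apply: cvg_sum => i _; have [+ _ _] := HW i; exact.
  by apply/funext => n; rewrite (scheme_psum sch).
have fu i t : 0 <= t -> f i (x n (step_index n t)) @[n --> U] --> f i (u t).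
  move=> t0; apply: (@continuous_cvg _ _ _ _ _ _ (f i)); first exact: fcont.
  exact: xu.
exists u, E, Th, W, P; split.
- by split=> //; rewrite /u E0 big1 ?subr0// => i _; have [_ ->] := HW i.
- by split=> // i; have [] := HTh i.
- by split=> i; [have [] := HW i|have [] := HP i].
- move=> t t0; split.
    apply: (closed_cvg _ Kclosed _ _ (xu t t0)); apply: nearW => n.
    by have [_ /(_ (step_index n t))[]] := sch n.
  have h1 : \sum_i psum (fun n k => theta n k i) n t @[n --> U] --> \sum_i Th i t.
    by apply: cvg_sum => i _; have [+ _ _] := HTh i; exact.
  apply: (cvg_unique (@norm_hausdorff _ R) h1).
  rewrite (_ : (fun n => _) = fun n => psum (fun _ _ => 1 : R) n t).
    exact: psum1_cvg.
  apply/funext => n; rewrite /psum -scaler_sumr exchange_big/=; congr (_ *: _).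
  by apply: eq_bigr => k _; have [_ /(_ k)[_ [_ ->]]] := sch n.
move=> t t0; have T0 : 0 < t + 1 by rewrite ltr_wpDl.
have [r [M [M0 xr B fM sdM]]] := bnd _ T0.
(* The product [A M] of [psum_quadratic] with [A = 2 M]. *)
exists (2 * M * M) => i s /andP[s0 s1].
have st0 : 0 <= s + t by rewrite addr_ge0// ltW.
have stT : s + t <= t + 1 by rewrite addrC lerD2l.
have tst : t <= s + t by rewrite lerDr ltW.
have ur : `|u t| <= r.
  apply: (cvgr_to_le (cvg_norm (xu t t0))); apply: nearW => n; apply: xr.
  have /andP[h1 _] := step_index_itv n t0; apply: le_trans h1 _.
  by rewrite lerDl.
have xM n k : k.+1%:R * step_size n <= t + 1 -> `|x n k.+1 - x n k| <= M * step_size n.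
  by move=> /(B n k)[].
have M2 : 0 <= 2 * M by rewrite mulr_ge0.
have quad c a b := @psum_quadratic R U UU ooU H x (u t) c (2 * M) M (t + 1) s t a b
  M2 M0 t0 (ltW s0) stT xM.
have Mle (y : R) : 0 <= y -> M * y <= 2 * M * y by move=> y0; rewrite ler_wpM2r//; lra.
(* Moving the base point from the iterate to [u t] costs [M] times their distance twice: once in the
   value of [f i], once in the pairing with [p n k i]. *)
have key n k y : k.+1%:R * step_size n <= t + 1 ->
    f i (u t) - f i y + form (p n k i) (y - u t) <= 2 * M * `|x n k.+1 - u t|.
  move=> kT; have [_ /(_ k)[_ _ _ /(_ i y) sp _]] := sch n.
  have [_ _ /(_ i) pM] := B n k kT.
  have := fM i _ _ ur (xr n _ kT) => /ler_normlP[_]; rewrite distrC => f1.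
  have -> : y - u t = (y - x n k.+1) + (x n k.+1 - u t) by rewrite addrA subrK.
  have := dot_le_norm hform (p n k i) (x n k.+1 - u t).
  have := ler_wpM2r (normr_ge0 (x n k.+1 - u t)) pM.
  rewrite dotDr; lra.
split.
- move=> v Kv; rewrite dotDl dotNl.
  apply: (quad (fun n k => form (eta n k) (v - u t))); last 2 first.
  + under eq_fun do rewrite psum_dot.
    by apply: (cvg_dot hform); [exact: Ec|exact: cvg_cst].
  + under eq_fun do rewrite psum_dot.
    by apply: (cvg_dot hform); [exact: Ec|exact: cvg_cst].
  + move=> n k kT; have [_ /(_ k)[_ _ [_ /(_ v Kv) nc] _ _]] := sch n.
    have [_ eM _] := B n k kT.
    have -> : v - u t = (v - x n k.+1) + (x n k.+1 - u t) by rewrite addrA subrK.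
    have := dot_le_norm hform (eta n k) (x n k.+1 - u t).
    have := ler_wpM2r (normr_ge0 (x n k.+1 - u t)) eM.
    have := Mle _ (normr_ge0 (x n k.+1 - u t)).
    rewrite dotDr; lra.
  + exact: xu.
- have [Tc _ _] := HTh i.
  apply: (cvgr_to_ge (cvgB (Tc _ st0) (Tc _ t0))); apply: nearW => n.
  rewrite [leRHS](psumB (fun n k => theta n k i : R) n tst).
  rewrite -[_ *: _]/(_ * _) mulr_ge0//; first exact/ltW/step_size_gt0.
  by apply: sumr_ge0 => k _; have /andP[] := th01 n k i.
- move=> y; have [Pc _ _] := HP i.
  (* The factor [1] stands for the constant sequence, whose integrals tend to [t]. *)
  pose c n k := (f i (u t) - f i y) * 1 + form (p n k i) (y - u t).
  have cc t' : 0 <= t' -> psum c n t' @[n --> U] -->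
      (f i (u t) - f i y) * t' + form (P i t') (y - u t).
    move=> t'0; under eq_fun do rewrite psumMD psum_dot.
    apply: cvgD; first by apply: cvgM; [exact: cvg_cst|exact: psum1_cvg].
    by apply: (cvg_dot hform); [exact: Pc|exact: cvg_cst].
  have := quad c _ _ _ (xu t t0) (cc _ t0) (cc _ st0).
  rewrite dotDl dotNl => h; apply: le_trans (h _); first lra.
  by move=> n k kT; rewrite /c mulr1; exact: key.
- move=> y; have [Wc _ _] := HW i; have [Tc _ _] := HTh i.
  pose c n k := (f i (u t) - f i y) * theta n k i + form (w i n k) (y - u t).
  have cc t' : 0 <= t' -> psum c n t' @[n --> U] -->
      (f i (u t) - f i y) * Th i t' + form (W i t') (y - u t).
    move=> t'0; under eq_fun do rewrite psumMD psum_dot.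
    apply: cvgD; first by apply: cvgM; [exact: cvg_cst|exact: Tc].
    by apply: (cvg_dot hform); [exact: Wc|exact: cvg_cst].
  have := quad c _ _ _ (xu t t0) (cc _ t0) (cc _ st0).
  rewrite dotDl dotNl => h; apply: le_trans (h _); first lra.
  (* The weight, between [0] and [1], multiplies the whole of [key], whose bound is nonnegative. *)
  move=> n k kT; rewrite /c /w dotZl mulrC -mulrDr.
  have /andP[th0 th1] := th01 n k i.
  apply: le_trans (ler_wpM2l th0 (key n k y kT)) _.
  by rewrite ler_piMl// mulr_ge0.
- move=> d.
  have hl : f i (x n (step_index n (s + t))) - f i (x n (step_index n t)) @[n --> U] -->
    f i (u (s + t)) - f i (u t) by apply: cvgB; exact: fu.
  have hr : - 2 * form d (x n (step_index n (s + t)) - x n (step_index n t)) +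
      (s + step_size n) * `|d| ^+ 2 @[n --> U] -->
      - 2 * form d (u (s + t) - u t) + s * `|d| ^+ 2.
    apply: cvgD.
      apply: cvgM; first exact: cvg_cst.
      by apply: (cvg_dot hform); [exact: cvg_cst|apply: cvgB; exact: xu].
    apply: cvgM; last exact: cvg_cst.
    rewrite -[X in _ --> X]addr0; apply: cvgD; first exact: cvg_cst.
    exact: step_size_cvg.
  apply: (ler_cvg_to hl hr); apply: nearW => n.
  have := scheme_energy hform sch n (step_index n t)
    (step_index n (s + t) - step_index n t) i d.
  rewrite subnKC ?step_index_le// => /le_trans; apply.
  rewrite lerD2l ler_wpM2r ?sqr_ge0//.
  by have := step_count n t0 tst; rewrite addrK.
Qed.

End limit_curves.

(** * Calculus of difference quotients *)

Section difference_quotients.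
Context {R : realType} {H : normedVectType R}.
Variable form : {dot H for idfun}.
Hypothesis hform : hilbert_norm form.

Lemma dquot_dot (F : R -> H) (t : R) (l z : H) :
  dquot_cvg F t l -> dquot_cvg (fun s => form (F s) z) t (form l z).
Proof.
move=> Fl; rewrite /dquot_cvg.
rewrite (_ : (fun h => _) = fun h => form (h^-1 *: (F (h + t) - F t)) z); last first.
  by apply/funext => h; rewrite dotZl dotDl dotNl.
by apply: (cvg_dot hform) => //; exact: cvg_cst.
Qed.

Lemma dquot_sum (V : normedModType R) (I : finType) (F : I -> R -> V) (t : R) (l : I -> V) :
  (forall i, dquot_cvg (F i) t (l i)) ->
  dquot_cvg (fun s => \sum_i F i s) t (\sum_i l i).
Proof.
move=> Fl; rewrite /dquot_cvg.
rewrite (_ : (fun h => _) = fun h => \sum_i h^-1 *: (F i (h + t) - F i t)).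
  by apply: cvg_sum => i _; exact: Fl.
by apply/funext => h; rewrite -scaler_sumr sumrB.
Qed.

Lemma dquotD (V : normedModType R) (F G : R -> V) (t : R) (l m : V) :
  dquot_cvg F t l -> dquot_cvg G t m -> dquot_cvg (fun s => F s + G s) t (l + m).
Proof.
move=> Fl Gm; rewrite /dquot_cvg.
rewrite (_ : (fun h => _) = fun h => h^-1 *: (F (h + t) - F t) + h^-1 *: (G (h + t) - G t)).
  exact: cvgD.
by apply/funext => h; rewrite -scalerDr opprD addrACA.
Qed.

Lemma dquotZ (V : normedModType R) (a : R) (F : R -> V) (t : R) (l : V) :
  dquot_cvg F t l -> dquot_cvg (fun s => a *: F s) t (a *: l).
Proof.
move=> Fl; rewrite /dquot_cvg.
rewrite (_ : (fun h => _) = fun h => a *: (h^-1 *: (F (h + t) - F t))).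
  exact: cvgZl_tmp.
by apply/funext => h; rewrite -scalerBr !scalerA mulrC.
Qed.

(** Pairing with [l] itself reduces to the scalar case and gives [|l|^2 <= M |l|]. *)
Lemma dquot_norm_le (F : R -> H) (t M : R) (l : H) : dquot_cvg F t l ->
  (forall s, 0 < s <= 1 -> `|F (s + t) - F t| <= M * s) -> `|l| <= M.
Proof.
move=> Fl FM; have [->|l0] := eqVneq l 0.
  rewrite normr0; have := FM 1; rewrite ltr01 lexx mulr1 => /(_ isT).
  exact: le_trans.
have : form l l <= M * `|l|.
  apply: (dquot_cvg_le (b := 0) (@dquot_dot F t l l Fl)) => s s01.
  rewrite mul0r addr0 -dotNl -dotDl (le_trans (dot_le_norm hform _ _))//.
  by rewrite mulrAC ler_wpM2r// FM.
by rewrite -hform expr2 ler_pM2r// normr_gt0.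
Qed.

End difference_quotients.
Arguments dquotZ {R V} a {F t l} _.
Arguments dquot_dot {R H form} hform {F t l} z _.

(** * Pointwise inclusions for the derivatives and minimality of the velocity *)

Section inclusions.
Context {R : realType} {H : normedVectType R}.
Variable form : {dot H for idfun}.
Hypothesis hform : hilbert_norm form.
Variables (K : set H) (q : nat) (f : 'I_q -> H -> R).
Variables (u0 : H) (u E : R -> H) (Th : 'I_q -> R -> R) (W P : 'I_q -> R -> H).
Hypotheses (q_gt0 : (0 < q)%N)
  (uE : forall t, u t = u0 - E t - \sum_i W i t)
  (Ku : forall t, 0 <= t -> K (u t)) (Th1 : forall t, 0 <= t -> \sum_i Th i t = t).
Variables (t b : R).
Hypotheses (t0 : 0 < t) (curves : forall i s, 0 < s <= 1 ->
  [/\ forall v, K v -> form (E (s + t) - E t) (v - u t) <= b * s ^+ 2,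
      0 <= Th i (s + t) - Th i t,
      forall y, (f i (u t) - f i y) * s + form (P i (s + t) - P i t) (y - u t)
        <= b * s ^+ 2,
      forall y, (f i (u t) - f i y) * (Th i (s + t) - Th i t) +
        form (W i (s + t) - W i t) (y - u t) <= b * s ^+ 2 &
      forall d, f i (u (s + t)) - f i (u t) <=
        - 2 * form d (u (s + t) - u t) + s * `|d| ^+ 2]).
Variables (l e : H) (th : 'I_q -> R) (w p : 'I_q -> H).
Hypotheses (ul : dquot_cvg u t l) (Ee : dquot_cvg E t e)
  (Tht : forall i, dquot_cvg (Th i) t (th i)) (Ww : forall i, dquot_cvg (W i) t (w i))
  (Pp : forall i, dquot_cvg (P i) t (p i)).

Lemma velocity_decomposition : l + e + \sum_i w i = 0.
Proof.
have h1 : dquot_cvg (fun s => u s + E s + \sum_i W i s) t (l + e + \sum_i w i).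
  by apply: dquotD; [exact: dquotD|exact: dquot_sum].
apply: (cvg_unique (@norm_hausdorff _ H) h1).
rewrite (_ : (fun h => _) = fun=> 0); first exact: cvg_cst.
apply/funext => h; rewrite !uE.
have cancel (a c d : H) : a - c - d + c + d = a by rewrite addrAC subrK subrK.
by rewrite !cancel subrr scaler0.
Qed.

Lemma normal_inclusion : normal_cone form K (u t) e.
Proof.
split; first exact/Ku/ltW.
move=> v Kv; apply: (dquot_cvg_le (b := b) (dquot_dot hform (v - u t) Ee)) => s s01.
rewrite mul0r add0r -dotNl -dotDl.
by have [h _ _ _ _] := curves (Ordinal q_gt0) s01; exact: h.
Qed.

Lemma weight_ge0 i : 0 <= th i.
Proof.
rewrite -oppr_le0; have := dquotZ (-1) (@Tht i); rewrite scaleN1r.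
move=> /(@dquot_cvg_le _ _ _ _ 0 0); apply => s s01.
have [_ h _ _ _] := curves i s01.
by rewrite -scalerBr scaleN1r !mul0r addr0 oppr_le0.
Qed.

Lemma weight_simplex : unit_simplex th.
Proof.
have s1 : \sum_i th i = 1.
  have ts (s : R) : 0 < s <= 1 -> 0 <= s + t by move=> /andP[? _]; rewrite addr_ge0// ltW.
  apply/eqP; rewrite eq_le; apply/andP; split.
    apply: (dquot_cvg_le (b := 0) (dquot_sum (@Tht))) => s s01.
    rewrite (Th1 (ts _ s01)) (Th1 (ltW t0)); lra.
  rewrite -lerN2; have := dquotZ (-1) (dquot_sum (@Tht)); rewrite scaleN1r.
  move=> /(@dquot_cvg_le _ _ _ _ (-1) 0); apply => s s01.
  rewrite (Th1 (ts _ s01)) (Th1 (ltW t0)) !scaleN1r; lra.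
split=> // i; rewrite weight_ge0/= -s1 (bigD1 i)//= lerDl.
by apply: sumr_ge0 => j _; exact: weight_ge0.
Qed.

Lemma subdiff_inclusion i : subdiff form (f i) (u t) (p i).
Proof.
move=> y; rewrite addrC -lerBrDr.
apply: (dquot_cvg_le (b := b) (dquot_dot hform (y - u t) (@Pp i))) => s s01.
have [_ _ /(_ y) h _ _] := curves i s01.
by rewrite -dotNl -dotDl; lra.
Qed.

Lemma weighted_subdiff_inclusion i y :
  (f i (u t) - f i y) * th i + form (w i) (y - u t) <= 0.
Proof.
have := dquotD (dquotZ (f i (u t) - f i y) (@Tht i)) (dquot_dot hform (y - u t) (@Ww i)).
move=> /(dquot_cvg_le (b := b)); apply => s s01.
have [_ _ _ /(_ y) h _] := curves i s01.
rewrite mul0r add0r; apply: le_trans h.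
rewrite dotDl dotNl -![_ *: _]/(_ * _); lra.
Qed.

(** The subgradient inequality bounds the increment of [f i] along [u] from below, the energy
    estimate with [d = l] from above. In the limit [<v, l> + 2 |l|^2 <= |l|^2]. *)
Lemma subgradient_energy i v : subdiff form (f i) (u t) v -> form v l <= - `|l| ^+ 2.
Proof.
move=> sv.
have : form l (v + 2 *: l) <= `|l| ^+ 2.
  apply: (dquot_cvg_le (b := 0) (dquot_dot hform (v + 2 *: l) ul)) => s s01.
  have [_ _ _ _ /(_ l) h] := curves i s01.
  have := sv (u (s + t)).
  rewrite -dotNl -dotDl (dotC form _ (v + _)) dotDl dotZl; lra.
rewrite dotDr dotZr -hform (dotC form l v); lra.
Qed.

(** The curve stays in [K], so the forward increments of [u] are admissible tests for [xi]. *)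
Lemma normal_energy xi : normal_cone form K (u t) xi -> form xi l <= 0.
Proof.
move=> [_ nxi]; rewrite dotC.
apply: (dquot_cvg_le (b := 0) (dquot_dot hform xi ul)) => s /andP[s0 _].
rewrite -dotNl -dotDl dotC !mul0r addr0; apply: nxi; apply: Ku.
by rewrite addr_ge0// ltW.
Qed.

(** Dividing the weighted subgradient by its weight fails where the weight vanishes; there [p i]
    supplies a subgradient. The explicit formula keeps the selection measurable in time. *)
Definition selected_subgradient i := if 0 < th i then (th i)^-1 *: w i else p i.

Lemma selected_subgradientP i :
  subdiff form (f i) (u t) (selected_subgradient i) /\
  th i *: selected_subgradient i = w i.
Proof.
rewrite /selected_subgradient; case: ifPn => [th0|].
  split; last by rewrite scalerA divff ?scale1r// gt_eqF.
  move=> y; have h := weighted_subdiff_inclusion i y.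
  rewrite dotZl addrC -lerBrDr ler_pdivrMl//; lra.
rewrite -leNgt => thle0; split; first exact: subdiff_inclusion.
have th00 : th i = 0 by apply/eqP; rewrite eq_le thle0 weight_ge0.
rewrite th00 scale0r; apply/esym/eqP; rewrite -normr_eq0 -sqrf_eq0 eq_le sqr_ge0 andbT.
(* With zero weight, the test point [u t + w i] gives [|w i|^2 <= 0]. *)
have := weighted_subdiff_inclusion i (w i + u t).
by rewrite th00 mulr0 add0r addrK -hform.
Qed.

(* The energy estimate gives [<z, l> <= - |l|^2] for every [z] in the sum, so that
   Cauchy-Schwarz makes [- l], which belongs to it, the element of minimal norm. *)
Lemma velocity_min_norm : is_min_norm
  [set x + y | x in normal_cone form K (u t) & y in conv_subdiff form f (u t)] (- l).
Proof.
split.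
  exists e; first exact: normal_inclusion.
  exists (\sum_i w i).
    exists th, selected_subgradient; split; first exact: weight_simplex.
      by move=> i; have [] := selected_subgradientP i.
    by apply: eq_bigr => i _; have [] := selected_subgradientP i.
  by apply/eqP; rewrite -addr_eq0 addrC addrA velocity_decomposition.
move=> _ [xi nxi [_ [lam [v [[lam01 lam1] sv ->]]] <-]].
have h1 : form (xi + \sum_i lam i *: v i) l <= - `|l| ^+ 2.
  rewrite dotDl dot_suml -[leRHS]add0r lerD ?normal_energy//.
  rewrite -[leRHS]mul1r -lam1 mulr_suml; apply: ler_sum => i _.
  have /andP[lam0 _] := lam01 i.
  by rewrite dotZl ler_wpM2l// (subgradient_energy (sv i)).
have [->|l0] := eqVneq l 0; first by rewrite oppr0 normr0.
rewrite normrN -(@ler_pM2r _ `|l|) ?normr_gt0// -expr2.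
have := dot_le_norm hform (- (xi + \sum_i lam i *: v i)) l.
rewrite normrN dotNl; lra.
Qed.

End inclusions.

(** * Assembly of the solution and of its measurable selections *)

Theorem theorem3p1 (R : realType) (H : normedVectType R)
    (form : {dot H for idfun}) (hform : hilbert_norm form)
    (K : set H) (K0 : K !=set0) (Kclosed : closed K) (Kconvex : convex_set K)
    (q : nat) (q_gt0 : (0 < q)%N) (f : 'I_q -> H -> R)
    (fconvex : forall i, convex_function [set: H] (f i))
    (fcont : forall i, continuous (f i))
    (flip : forall i (B : set H), bounded_set B -> [lipschitz f i x | x in B])
    (fbound : forall i, has_lbound (range (f i)))
    (u0 : H) (Ku0 : K u0) :
  exists2 u : R -> H, strong_global_solution form K f u & u 0 = u0.
Proof.
have [u [E [Th [W [P [[u00 uE] [El Thl] [Wl Pl] KT curves]]]]]] :=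
  limit_curves hform Kclosed Kconvex q_gt0 fconvex fcont flip fbound Ku0.
have Ku t (t0 : 0 <= t) : K (u t) by have [] := KT t t0.
have Th1 t (t0 : 0 <= t) : \sum_i Th i t = t by have [] := KT t t0.
pose mu := @lebesgue_measure R.
pose e := vbasis {:H}.
have ul : locally_lipschitz u.
  move=> T T0; have [M M0 HM] := El T T0.
  have /choice[N HN] : forall i, exists N : R, 0 <= N /\ forall s t : R,
      0 <= s -> s <= t -> t <= T -> `|W i t - W i s| <= N * (t - s).
    by move=> i; have [N N0 HN] := Wl i T T0; exists N.
  exists (M + \sum_i N i).
    by rewrite addr_ge0// sumr_ge0// => i _; have [] := HN i.
  move=> s t s0 st tT; rewrite !uE.
  have -> : u0 - E t - \sum_i W i t - (u0 - E s - \sum_i W i s) =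
      - ((E t - E s) + \sum_i (W i t - W i s)).
    rewrite sumrB; set a := \sum_i _; set b := \sum_i _.
    rewrite !opprD !opprK addrACA; congr (_ + _).
    by rewrite addrACA subrr add0r.
  rewrite normrN mulrDl mulr_suml (le_trans (ler_normD _ _))// lerD ?HM//.
  rewrite (le_trans (ler_norm_sum _ _ _))// ler_sum// => i _.
  by have [_] := HN i; exact.
have [du [_ idu duE aeu]] := vector_locally_lipschitz_density ul.
have [dE [mdE _ _ aeE]] := vector_locally_lipschitz_density El.
have hW : forall i, exists g : R -> H,
    (forall j, measurable_fun setT (fun t => coord e j (g t))) /\
    {ae mu, forall t : R, 0 < t -> dquot_cvg (W i) t (g t)}.
  by move=> i; have [g [? _ _ ?]] := vector_locally_lipschitz_density (Wl i); exists g.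
have hP : forall i, exists g : R -> H,
    (forall j, measurable_fun setT (fun t => coord e j (g t))) /\
    {ae mu, forall t : R, 0 < t -> dquot_cvg (P i) t (g t)}.
  by move=> i; have [g [? _ _ ?]] := vector_locally_lipschitz_density (Pl i); exists g.
have hTh : forall i, exists g : R -> R, measurable_fun setT g /\
    {ae mu, forall t : R, 0 < t -> dquot_cvg (Th i) t (g t)}.
  move=> i; have [g [mg _ _ aeg]] := locally_lipschitz_density (Thl i).
  by exists g; split => //; apply: filterS aeg => t h t0; exact/dquot_cvgP/h.
have [dW HW] := choice hW; have [dP HP] := choice hP; have [dTh HTh] := choice hTh.
have aeW : {ae mu, forall t : R, forall i, 0 < t -> dquot_cvg (W i) t (dW i t)}.
  by apply: filter_forall => i; have [] := HW i.
have aeP : {ae mu, forall t : R, forall i, 0 < t -> dquot_cvg (P i) t (dP i t)}.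
  by apply: filter_forall => i; have [] := HP i.
have aeTh : {ae mu, forall t : R, forall i, 0 < t -> dquot_cvg (Th i) t (dTh i t)}.
  by apply: filter_forall => i; have [] := HTh i.
(* Truncation makes the bounds hold at every time; almost everywhere it changes nothing, the
   derivatives being already in the simplex. *)
pose th i t := Num.max 0 (Num.min (dTh i t) 1).
pose v i t := selected_subgradient (th ^~ t) (dW ^~ t) (dP ^~ t) i.
have th01 i t : 0 <= th i t <= 1.
  by rewrite le_max lexx/= ge_max ler01 ge_min lexx orbT.
(* At almost every time all the curves are differentiable at once, finitely many null sets being
   discarded; the pointwise results then apply. *)
have good : {ae mu, forall t : R, 0 < t ->
   [/\ dquot_cvg u t (du t), dquot_cvg E t (dE t),
       unit_simplex (th ^~ t),
       normal_cone form K (u t) (dE t) /\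
       (forall i, subdiff form (f i) (u t) (v i t) /\ th i t *: v i t = dW i t) &
       du t + dE t + \sum_i dW i t = 0 /\
       is_min_norm [set x + y | x in normal_cone form K (u t)
                              & y in conv_subdiff form f (u t)] (- du t)]}.
  apply: filterS (filterI (filterI aeu aeE) (filterI aeTh (filterI aeW aeP))).
  move=> t [[du_ dE_] [dTh_ [dW_ dP_]]] t0.
  have {}du_ := du_ t0; have {}dE_ := dE_ t0.
  have {}dTh_ i := dTh_ i t0; have {}dW_ i := dW_ i t0; have {}dP_ i := dP_ i t0.
  have [b curv] := curves t (ltW t0).
  have simplex := weight_simplex Th1 t0 curv dTh_.
  have thE : th ^~ t = dTh ^~ t.
    apply/funext => i; have [/(_ i)/andP[h0 h1] _] := simplex.
    by rewrite /th min_l// max_r.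
  split=> //; first by rewrite thE.
    split; first exact: (normal_inclusion hform q_gt0 Ku t0 curv dE_).
    move=> i; rewrite /v thE -[th i t]/((th ^~ t) i) thE.
    exact: (selected_subgradientP hform curv dTh_ dW_ dP_ i).
  split; first exact: (velocity_decomposition uE du_ dE_ dW_).
  exact: (velocity_min_norm hform q_gt0 uE Ku Th1 t0 curv du_ dE_ dTh_ dW_ dP_).
have mth i : measurable_fun setT (th i).
  apply: measurable_maxr; first exact: measurable_cst.
  by apply: measurable_minr; [have [] := HTh i|exact: measurable_cst].
have mthV i : measurable_fun setT (fun t => (th i t)^-1).
  (* As [th i t] is nonnegative, its inverse is a real power, and measurability follows from that of
     powers. *)
  rewrite (_ : (fun t => _) = fun t => (th i t) `^ (-1)).
    by apply: (@measurableT_comp _ _ _ _ _ _ (@powR R ^~ (-1))).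
  by apply/funext => t; rewrite powR_inv1//; have /andP[] := th01 i t.
have mv i (D : set R) : measurable (D : set (measurableTypeR R)) -> vmeasurable D (v i).
  move=> mD; apply: vmeasurable_coord => // j; apply: (@measurable_funS _ _ _ _ setT) => //.
  rewrite (_ : (fun t => _) = fun t => if 0 < th i t
      then (th i t)^-1 * coord (vbasis {:H}) j (dW i t)
      else coord (vbasis {:H}) j (dP i t)).
    apply: measurable_fun_ifT.
    - exact: (measurable_fun_ltr (measurable_cst _) (mth i)).
    - by have [mW _] := HW i; exact: (measurable_funM (mthV i) (mW j)).
    - by have [mP _] := HP i; exact: (mP j).
  apply/funext => t; rewrite /v /selected_subgradient.
  by case: ifP => // _; rewrite linearZ.
have mE (D : set R) : measurable (D : set (measurableTypeR R)) -> vmeasurable D dE.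
  move=> mD; apply: vmeasurable_coord => // j.
  exact: (measurable_funS measurableT (@subsetT _ _) (mdE j)).
have mnorm T (g : R -> H) : vmeasurable `]0, T[%classic g ->
    measurable_fun (setT : set (measurableTypeR R)) ((fun t => `|g t|) \_ `]0, T[%classic).
  move=> mg; have mD : measurable (`]0, T[%classic : set (measurableTypeR R)).
    exact: measurable_itv.
  by apply/(measurable_restrictT _ mD); exact: vmeasurable_norm.
exists u => //; split.
  move=> T T0; exists du; first exact: idu.
  by move=> t; rewrite in_itv/= => /andP[t0 _]; exact: duE.
exists dE, v, th; split.
- by move=> i t _; exact: th01.
- move=> i; apply: (@ae_bounded_Lfun_oo _ _ 1).
    apply/(measurable_restrictT (th i) (measurable_itv `]0, +oo[)).
    exact: measurable_funS (mth i).
  apply: filterS good => t _; rewrite patchE; case: ifP => _; last by rewrite normr0.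
  by have /andP[? ?] := th01 i t; rewrite ger0_norm.
- by apply: filterS good => t h /h[].
- move=> T T0; have mD : measurable (`]0, T[%classic : set (measurableTypeR R)).
    exact: measurable_itv.
  split=> [i|]; split; [exact: mv| |exact: mE|].
  (* [u] stays in the ball of radius [r] up to time [T]; the subgradient bound needs a Lipschitz
     constant on radius [r + 1]. *)
  + have [Mu Mu0 HMu] := ul T T0; pose r := `|u0| + Mu * T.
    have [L L0 HL] := lipschitz_ball (@flip i) (r + 1).
    apply: (@ae_bounded_Lfun_oo _ _ L); first exact: (mnorm _ _ (mv i _ mD)).
    apply: filterS good => t h; rewrite patchE; case: ifPn => [tD|_]; last by rewrite normr0.
    move: tD; rewrite inE/= in_itv/= => /andP[t0 tT].
    have [_ _ _ [_ /(_ i)[sv _]] _] := h t0.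
    rewrite normr_id; apply: (subdiff_norm_le hform HL L0 _ sv).
    rewrite -[u t](subrK (u 0)) addrC u00 (le_trans (ler_normD _ _))// lerD2l.
    rewrite -u00 (le_trans (HMu _ _ _ (ltW t0) (ltW tT)))// subr0.
    by rewrite ler_wpM2l// ltW.
  (* Difference quotients at times below [T] look ahead by at most [1]. *)
  + have [M M0 HM] := El (T + 1) (addr_gt0 T0 ltr01).
    apply: (@ae_bounded_Lfun_2 _ _ M T); first exact: (mnorm _ _ (mE _ mD)).
      apply: filterS good => t h /andP[t0 tT].
      have [_ dE_ _ _ _] := h t0; rewrite patchE ifT ?inE/= ?in_itv/= ?t0//.
      rewrite normr_id; apply: (dquot_norm_le hform dE_) => s /andP[s0 s1].
      have tst : t <= s + t by rewrite lerDr ltW.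
      have stT : s + t <= T + 1 by rewrite addrC lerD// ltW.
      by have := HM _ _ (ltW t0) tst stT; rewrite addrK.
    by move=> t nt; rewrite patchE ifF//; apply/negP; rewrite inE/= in_itv.
apply: filterS good => t h t0.
have [du_ dE_ _ [nE sv] [dec mn]] := h t0.
have [derU dU] := (proj1 (dquot_cvgP _ _ _) du_).
split=> //; first by move=> i; have [] := sv i.
  rewrite dU (eq_bigr (fun i => dW i t)) ?dec// => i _.
  by have [] := sv i.
by exists (- du t) => //; rewrite dU subrr.
Qed.
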